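(* Let $T$ be a power-bounded operator on a complex Banach space $X$, and assume that $T$ has a bounded $\mathcal{B}$-calculus. Let $f \in \mathcal{B}(\mathbb{D})$, and assume that $f$ vanishes on $\sigma_u(T)$. Then $\lim_{n\to\infty} \|T^n f(T)\| = 0$.
   Context: $\mathbb{D}$ is the open unit disc in $\mathbb{C}$, $\mathbb{T}$ is the unit circle, $\overline{\mathbb{D}}=\mathbb{D}\cup\mathbb{T}$. $L(X)$ is the Banach algebra of bounded linear operators on $X$. $T\in L(X)$ is power-bounded if $\sup_{n\ge 0}\|T^n\|<\infty$. The unitary spectrum of $T$ is $\sigma_u(T):=\sigma(T)\cap\mathbb{T}$. $\mathcal{B}(\mathbb{D})$ is the space of all holomorphic functions $f$ on $\mathbb{D}$ such that $\|f\|_{\mathcal{B}_0}:=\int_0^1 \sup_{|\theta|\le\pi}|f'(re^{i\theta})|\,dr<\infty$. Every $f\in\mathcal{B}(\mathbb{D})$ extends to a continuous function on $\overline{\mathbb{D}}$, also denoted by $f$, and in particular is bounded. With pointwise operations and the norm $\|f\|_{\mathcal{B}}:=\|f\|_\infty+\|f\|_{\mathcal{B}_0}$, where $\|f\|_\infty:=\sup_{z\in\mathbb{D}}|f(z)|$, $\mathcal{B}(\mathbb{D})$ is a Banach algebra, in which the polynomials are dense. $T\in L(X)$ has a bounded $\mathcal{B}$-calculus if there is a bounded algebra homomorphism $\mathcal{B}(\mathbb{D})\to L(X)$ mapping the constant function $1$ to the identity operator $I$ and the identity function $z$ to $T$. It is then unique (by density of polynomials), and $f(T)$ denotes the image of $f$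 under it. *)

(* Defs.v *)
From HB Require Import structures.
From mathcomp Require Import all_boot all_order all_algebra.
From mathcomp Require Import complex.
From mathcomp Require Import all_classical all_reals all_analysis.

Set Implicit Arguments.
Unset Strict Implicit.
Unset Printing Implicit Defensive.

Import Order.TTheory GRing.Theory Num.Theory.
Import numFieldNormedType.Exports.

Local Open Scope classical_set_scope.
Local Open Scope complex_scope.
Local Open Scope ring_scope.

(* Norms on [R[i]] and on normed modules over [R[i]] take their values in
   [R[i]] (and are real and nonnegative there); this is their real value. *)
Definition rnorm (R : realType) (V : normedModType R[i]) (x : V) : R :=
  complex.Re `|x|.

Section Disc.
Variable R : realType.

Definition disc : set R[i] := [set z | `|z| < 1].

Definition circle : set R[i] := [set z | `|z| = 1].

Definition polar (r t : R) : R[i] := r%:C * (cos t +i* sin t).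

(* Functions on the disc are total functions on the plane whose values outside
   the disc are never used: all the notions below only depend on the values on
   [disc], which is open. *)

(* [derivable] over the field [R[i]] is complex differentiability. *)
Definition holomorphic_on_disc (f : R[i]^o -> R[i]^o) : Prop :=
  forall z, disc z -> derivable f z 1.

Definition supnorm (f : R[i]^o -> R[i]^o) : \bar R :=
  ereal_sup [set (rnorm (f z))%:E | z in disc].

Definition B0norm (f : R[i]^o -> R[i]^o) : \bar R :=
  (\int[lebesgue_measure]_(r in `]0%R, 1%R[)
    ereal_sup [set (rnorm (derive1 f (polar r t)))%:E | t in `[(- pi)%R, pi]])%E.

Definition Bnorm (f : R[i]^o -> R[i]^o) : \bar R := (supnorm f + B0norm f)%E.

Definition inB (f : R[i]^o -> R[i]^o) : Prop :=
  holomorphic_on_disc f /\ (B0norm f < +oo)%E.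

(* Value at [z] of the continuous extension of [f] to the closed disc; for [f]
   in B(D) the limit exists at every point of the closed disc. *)
Definition disc_ext (f : R[i]^o -> R[i]^o) (z : R[i]^o) : R[i]^o :=
  lim (f w @[w --> within disc (nbhs z)]).

End Disc.

Section Operators.
Variables (R : realType) (X : completeNormedModType R[i]).

Definition opnorm (T : X -> X) : \bar R :=
  ereal_sup [set (rnorm (T x))%:E | x in [set x | rnorm x <= 1]].

Record bounded_op := BoundedOp {
  op_linear :> {linear X -> X};
  op_bounded : (opnorm op_linear < +oo)%E }.

Definition power_bounded (T : bounded_op) : Prop :=
  (ereal_sup [set opnorm (iter n T) | n in [set: nat]] < +oo)%E.

Definition spectrum (T : bounded_op) : set R[i] :=
  [set l | ~ exists S : bounded_op,
     (forall x, S (l *: x - T x) = x) /\ (forall x, l *: S x - T (S x) = x)].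

Definition unitary_spectrum (T : bounded_op) : set R[i] :=
  spectrum T `&` @circle R.

(* [Phi] is a bounded homomorphism of complex algebras from B(D) to L(X) mapping
   1 to the identity and z to [T]; its values outside [inB] are irrelevant.  The
   norm bound forces [Phi f] to depend only on the values of [f] on the disc. *)
Record bounded_B_calculus (T : bounded_op)
    (Phi : (R[i]^o -> R[i]^o) -> bounded_op) : Prop := {
  calculusD : forall f g, inB f -> inB g ->
    forall x, Phi (fun z => f z + g z) x = Phi f x + Phi g x;
  calculusZ : forall (c : R[i]) f, inB f ->
    forall x, Phi (fun z => c * f z) x = c *: Phi f x;
  calculusM : forall f g, inB f -> inB g ->
    forall x, Phi (fun z => f z * g z) x = Phi f (Phi g x);
  calculus1 : forall x, Phi (fun=> 1) x = x;
  calculus_id : forall x, Phi (fun z => z) x = T x;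
  calculus_bounded : exists M : R, forall f, inB f ->
    (opnorm (Phi f) <= M%:E * Bnorm f)%E }.

End Operators.

(* Main.v *)
Require Import Defs.
From mathcomp Require Import all_boot all_order all_algebra.
From mathcomp Require Import complex.
From mathcomp Require Import all_classical all_reals all_analysis.
From mathcomp Require Import measurable_realfun.
From mathcomp Require Import zify ring lra.

(** Why the theorem holds.  Write [p f] for the product of a polynomial [p] and
    [f], so that [T^n (Phi (p f)) = Phi (z^n p f)].

    Along large powers of [T] the calculus only sees the sup norm.  If [h] is in
    [B] and [|h| <= L] on the disc, then [(z^n h)' = n z^(n-1) h + z^n h'], where
    the first term contributes at most [int n r^(n-1) L dr = L] to the B-norm and
    the second one tends to [0].  Hence the B-norm of [z^n h] is asymptotically at
    most [2 L] ([Bnorm_shift_le]), and [T^n (Phi (p f))] is asymptotically at most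
    [2 M sup |p f|] in norm, [M] being the norm of the calculus
    ([calculus_iter_le]).

    Parts of [f] living near the resolvent set are invisible.  If a point [u] of
    the circle is not in the spectrum, then [|y| <= C |u y - T y|] for all [y].
    Using this [m] times, [|T^n (Phi (p f)) x|] is at most [C^m] times
    [|T^n (Phi ((u - z)^m p f)) x|] ([bounded_below_iter]), so asymptotically at
    most [2 M sup |C (u - z)|^m |p f|].  This is tiny when [p] is concentrated
    on [|z - u| < 1 / (2 C)].

    Now cut [f] into pieces.  By compactness, for every [eps > 0] each point [u]
    of the circle is of one of two kinds, with constants that do not depend on
    [u]: either the lower bound above holds at [u], or [|f| <= eps] on the disc
    near [u] ([circle_dichotomy]); the second case covers the unitary spectrum
    because [f] extends continuously by [0] there.  The monomial [z^N] is a sum of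
    polynomials [Q_k] peaking at the [(N + 1)]-st roots of unity, bounded by
    [sum |Q_k| <= 1] on the disc and exponentially small in [N] away from their
    peaks ([circle_partition]).  Peaks of the first kind are treated by the second
    step, the sum of all others is multiplied by [f] into a function that is
    nearly bounded by [eps] and is treated by the first step.  Together they
    bound [T^n (Phi f) = T^(n - N) (Phi (z^N f))] ([calculus_iter_small]).

    In these estimates [sup |f'|] over circles is an arbitrary nonnegative
    function of the radius, and its integral a lower integral: the supremum of
    the integrals of simple functions below it.  The boundary values of [f] come
    from the inequality [|f (b w) - f (a w)| <= int_a^b |f' (r w)| dr],
    valid for any everywhere differentiable function
    ([rnorm_increment_le_integral]). *)

Set Implicit Arguments.
Unset Strict Implicit.
Unset Printing Implicit Defensive.

Import Order.TTheory GRing.Theory Num.Theory.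
Import numFieldNormedType.Exports.

Local Open Scope classical_set_scope.
Local Open Scope complex_scope.
Local Open Scope ring_scope.

(** * Real-valued norms and polar coordinates *)

Section RealNorm.
Variables (R : realType).
Implicit Types V : normedModType R[i].
Local Notation cmod := (@rnorm R R[i]^o).

Lemma rnormE V (x : V) : `|x| = (rnorm x)%:C.
Proof. by rewrite /rnorm RRe_real// normr_real. Qed.

Lemma rnormCE (z : R[i]) : `|z| = (cmod z)%:C.
Proof. exact: (@rnormE R[i]^o). Qed.

Lemma rnorm_ge0 V (x : V) : 0 <= rnorm x.
Proof. by rewrite -ler0c -rnormE. Qed.

Lemma rnorm0 V : rnorm (0 : V) = 0.
Proof. by rewrite /rnorm normr0. Qed.

Lemma rnorm_eq0 V (x : V) : rnorm x = 0 -> x = 0.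
Proof. by move=> x0; apply/normr0_eq0; rewrite rnormE x0. Qed.

Lemma rnormN V (x : V) : rnorm (- x) = rnorm x.
Proof. by rewrite /rnorm normrN. Qed.

Lemma rnormB V (x y : V) : rnorm (x - y) = rnorm (y - x).
Proof. by rewrite -rnormN opprB. Qed.

Lemma ler_rnormD V (x y : V) : rnorm (x + y) <= rnorm x + rnorm y.
Proof. by rewrite -lecR -rnormE rmorphD/= -2!rnormE; exact: ler_normD. Qed.

Lemma ler_rnormB V (x y z : V) : rnorm (x - z) <= rnorm (x - y) + rnorm (y - z).
Proof. by rewrite -[x - z](subrKA y) ler_rnormD. Qed.

Lemma ler_dist_rnorm V (x y : V) : `|rnorm x - rnorm y| <= rnorm (x - y).
Proof.
have := ler_rnormD (x - y) y; have := ler_rnormD (y - x) x.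
by rewrite !subrK (rnormB y) ler_norml => ? ?; apply/andP; split; lra.
Qed.

Lemma ler_rnorm_sum V I (r : seq I) (P : pred I) (F : I -> V) :
  rnorm (\sum_(i <- r | P i) F i) <= \sum_(i <- r | P i) rnorm (F i).
Proof.
elim/big_rec2: _ => [|i y x _ yx]; first by rewrite rnorm0.
by rewrite (le_trans (ler_rnormD _ _))// lerD2l.
Qed.

Lemma rnormZ V (c : R[i]) (x : V) :
  rnorm (c *: x) = cmod c * rnorm x.
Proof. by apply: complexI; rewrite rmorphM/= -!rnormE normrZ. Qed.

Lemma rnormM (a b : R[i]^o) : rnorm (a * b : R[i]^o) = rnorm a * rnorm b.
Proof. exact: (@rnormZ R[i]^o). Qed.

Lemma rnorm1 : cmod 1 = 1.
Proof. by rewrite /rnorm normr1. Qed.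

Lemma rnormX (a : R[i]^o) n : rnorm (a ^+ n : R[i]^o) = rnorm a ^+ n.
Proof. by rewrite /rnorm normrX rnormCE -rmorphXn. Qed.

Lemma rnorm_real (r : R) : rnorm (r%:C : R[i]^o) = `|r|.
Proof. by rewrite /rnorm normc_def/= expr0n/= addr0 sqrtr_sqr. Qed.

Lemma rnorm_sqr (z : R[i]^o) : rnorm z ^+ 2 = complex.Re z ^+ 2 + complex.Im z ^+ 2.
Proof. by apply: complexI; rewrite add_Re2_Im2 rnormCE rmorphXn. Qed.

Lemma rnorm_sqrJ (z : R[i]^o) : (rnorm z ^+ 2)%:C = z * z^*%C.
Proof. by rewrite -sqr_normc rnormCE rmorphXn. Qed.

Lemma ler_Re_cmod (z : R[i]) : `|complex.Re z| <= cmod z.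
Proof.
rewrite -(@ler_pXn2r _ 2) ?nnegrE ?rnorm_ge0//.
by rewrite rnorm_sqr real_normK ?num_real// lerDl sqr_ge0.
Qed.

Lemma ler_Im_cmod (z : R[i]) : `|complex.Im z| <= cmod z.
Proof.
rewrite -(@ler_pXn2r _ 2) ?nnegrE ?rnorm_ge0//.
by rewrite rnorm_sqr real_normK ?num_real// lerDr sqr_ge0.
Qed.

Lemma ler_cmod_ReIm (z : R[i]) : cmod z <= `|complex.Re z| + `|complex.Im z|.
Proof.
rewrite -(@ler_pXn2r _ 2) ?nnegrE ?rnorm_ge0// ?addr_ge0//.
rewrite rnorm_sqr sqrrD !real_normK ?num_real// lerD2r lerDl.
by rewrite mulrn_wge0// mulr_ge0.
Qed.

Lemma discE (z : R[i]) : disc z = (cmod z < 1).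
Proof. by rewrite /disc/= rnormCE -[1]/(1%:C) ltcR. Qed.

Lemma circleE (z : R[i]) : circle z <-> cmod z = 1.
Proof.
rewrite /circle/= rnormCE -[1 in X in X <-> _]/(1%:C).
by split=> [/complexI//|->].
Qed.

Lemma cmod_polar (r t : R) : cmod (polar r t) = `|r|.
Proof.
rewrite /polar rnormM rnorm_real; set z := (X in _ * rnorm X).
suff -> : cmod z = 1 by rewrite mulr1.
apply/eqP; rewrite -(@eqrXn2 _ 2) ?rnorm_ge0//; apply/eqP.
by rewrite rnorm_sqr/= cos2Dsin2 expr1n.
Qed.

Lemma polarM (r s t : R) : polar (r * s) t = r%:C * polar s t.
Proof. by rewrite /polar rmorphM mulrA. Qed.

Lemma polarD (r h t : R) : polar (r + h) t = polar r t + polar h t.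
Proof. by rewrite /polar rmorphD/= mulrDl. Qed.

Lemma polarNr (h t : R) : polar (- h) t = - polar h t.
Proof. by rewrite /polar rmorphN/= mulNr. Qed.

Lemma disc_polar (r t : R) : disc (polar r t) = (`|r| < 1) :> Prop.
Proof. by rewrite discE cmod_polar. Qed.

Lemma polar_surj (z : R[i]^o) :
  exists2 t, t \in `[(- pi)%R, pi] & z = polar (rnorm z) t.
Proof.
have [z0|z0] := eqVneq (rnorm z) 0.
  exists 0; first by rewrite in_itv/= oppr_le0 !pi_ge0.
  by rewrite /polar z0 mul0r; exact: rnorm_eq0.
have zgt0 : 0 < rnorm z by rewrite lt_neqAle eq_sym z0 rnorm_ge0.
pose a := complex.Re z / rnorm z; pose b := complex.Im z / rnorm z.
have ab1 : a ^+ 2 + b ^+ 2 = 1.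
  rewrite !exprMn -mulrDl -rnorm_sqr exprVn divff// expf_eq0/=.
  by rewrite (negbTE z0).
have a1 : -1 <= a <= 1.
  rewrite -ler_norml -(@ler_pXn2r _ 2) ?nnegrE// real_normK ?num_real// expr1n.
  by rewrite -ab1 lerDl sqr_ge0.
have zE : z = (rnorm z)%:C * (a +i* b).
  rewrite /a /b; case: z z0 {a b ab1 a1 zgt0} => x y z0 /=; set n := rnorm _ in z0 *.
  by apply/eqP; rewrite eq_complex/=; rewrite !mul0r subr0 addr0 ![n * _]mulrC !divfK// !eqxx.
have c0 := acos_ge0 a1; have cp := acos_lepi a1.
have sE : sin (acos a) = `|b|.
  by rewrite sin_acos// -ab1 addrC addKr sqrtr_sqr.
have [b0|b0] := leP 0 b.
  exists (acos a); first by rewrite in_itv/= cp andbT (le_trans _ c0)// oppr_le0 pi_ge0.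
  by rewrite /polar acosK ?in_itv// sE ger0_norm.
exists (- acos a).
  by rewrite in_itv/= lerN2 cp/= (le_trans _ (pi_ge0 _))// oppr_le0.
by rewrite /polar cosN sinN acosK ?in_itv// sE ltr0_norm// opprK.
Qed.

End RealNorm.

(** * Integrals of functions that need not be measurable *)

Section LowerIntegral.
Context d (T : measurableType d) (R : realType).
Variable mu : {measure set T -> \bar R}.
Implicit Types (D : set T) (F : T -> \bar R).

Import HBNNSimple.

Lemma lower_integral_mono D (g F : T -> \bar R) : measurable D ->
  (forall x, D x -> 0 <= g x)%E ->
  (forall x, D x -> g x <= F x)%E ->
  (\int[mu]_(x in D) g x <= \int[mu]_(x in D) F x)%E.
Proof.
move=> mD g0 gF.
have F0 x : D x -> (0 <= F x)%E by move=> Dx; rewrite (le_trans (g0 _ Dx))// gF.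
rewrite !ge0_integralE//; apply: le_ereal_sup => _ [h hg <-].
exists h => // x.
by rewrite (le_trans (hg x))// lee_restrict.
Qed.

(** A simple function below the extension of [F] by zero vanishes off [D]. *)
Lemma sintegral_minorant D F (h : {nnsfun T >-> R}) :
  (forall x, (h x)%:E <= (F \_ D) x)%E ->
  sintegral mu h = (\int[mu]_(x in D) (h x)%:E)%E.
Proof.
move=> hF; rewrite integral_mkcond -integralT_nnsfun; apply: eq_integral => x _ /=.
rewrite !patchE; case: ifPn => // xD.
have := hF x; rewrite patchE (negbTE xD) lee_fin => h0.
by congr EFin; apply/eqP; rewrite eq_le h0/=; exact: fun_ge0.
Qed.

(** Upper bounds on a lower integral are proved on the simple minorants of [F]. *)
Lemma lower_integral_le D F (A : \bar R) : measurable D ->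
  (forall x, D x -> 0 <= F x)%E ->
  (forall g : T -> R, measurable_fun setT g -> (forall x, 0 <= g x) ->
    (forall x, D x -> (g x)%:E <= F x)%E -> (\int[mu]_(x in D) (g x)%:E <= A)%E) ->
  (\int[mu]_(x in D) F x <= A)%E.
Proof.
move=> mD F0 gA; rewrite ge0_integralE//; apply: ge_ereal_sup => _ [h hF <-].
have hFD x : D x -> ((h x)%:E <= F x)%E.
  by move=> Dx; have := hF x; rewrite patchE mem_set.
rewrite (sintegral_minorant hF).
by apply: gA => // x; exact: fun_ge0.
Qed.

(** Absolute continuity of the lower integral.  Pick a
    simple [phi <= F] that captures the integral of [F] up to [eps].  If
    [v <= w F] is measurable, then [v + (1 - w) phi <= F], so the integral of [v]
    exceeds that of [w phi] by at most [eps], and [phi] is bounded by some [C]. *)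
Lemma lower_integral_weight D F (eps : R) : measurable D ->
  (forall x, D x -> 0 <= F x)%E ->
  (\int[mu]_(x in D) F x < +oo)%E -> 0 < eps ->
  exists2 C : R, 0 <= C & forall w : T -> R,
    measurable_fun D w -> (forall x, D x -> 0 <= w x <= 1) ->
    (\int[mu]_(x in D) ((w x)%:E * F x) <=
     eps%:E + C%:E * \int[mu]_(x in D) (w x)%:E)%E.
Proof.
move=> mD F0 Foo eps0.
have Ffin : (\int[mu]_(x in D) F x)%E \is a fin_num.
  by rewrite ge0_fin_numE// integral_ge0.
have [phi phiF phi_eps] : exists2 phi : {nnsfun T >-> R},
    (forall x, D x -> (phi x)%:E <= F x)%E &
    (\int[mu]_(x in D) F x <= eps%:E + \int[mu]_(x in D) (phi x)%:E)%E.
  have := Ffin; rewrite ge0_integralE// => /ub_ereal_sup_adherent => /(_ _ eps0).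
  rewrite -ge0_integralE// => -[_ [h hF <-]] heps.
  have hFD x : D x -> ((h x)%:E <= F x)%E.
    by move=> Dx; have := hF x; rewrite patchE mem_set.
  exists h => //.
  rewrite -(sintegral_minorant hF).
  by rewrite -leeBlDl//; exact: ltW.
have phi0 x : 0 <= phi x by exact: fun_ge0.
have [C C0 phiC] : exists2 C : R, 0 <= C & forall x, phi x <= C.
  have [M _ phiM] : exists2 M : R, M \is Num.real & forall x, phi x <= M.
    have [M [Mreal phiM]] := simple_bounded phi; exists (M + 1).
      by rewrite realD.
    move=> x; rewrite (le_trans (ler_norm _))//.
    by apply: (phiM (M + 1)) => //; rewrite ltrDl.
  by exists (Num.max M 0); rewrite ?le_max ?lexx ?orbT// => x; rewrite le_max phiM.
exists C => // w mw w01.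
have wF0 x : D x -> (0 <= (w x)%:E * F x)%E.
  by move=> Dx; rewrite mule_ge0 ?F0// lee_fin; case/andP: (w01 x Dx).
apply: lower_integral_le => // v mvT v0 vwF.
have mv : measurable_fun D v by exact: measurable_funTS.
have mphi : measurable_fun D phi by exact: measurable_funTS.
have m1w : measurable_fun D (fun x => (1 - w x) * phi x).
  by apply: measurable_funM => //; exact: measurable_funB.
have mwp : measurable_fun D (fun x => w x * phi x) by apply: measurable_funM.
have w1 x : D x -> 0 <= 1 - w x by move=> /w01/andP[_]; rewrite subr_ge0.
have w0 x : D x -> 0 <= w x by move=> /w01/andP[].
have p1 x : D x -> 0 <= (1 - w x) * phi x by move=> Dx; rewrite mulr_ge0// w1.
have p2 x : D x -> 0 <= w x * phi x by move=> Dx; rewrite mulr_ge0// w0.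
set I1 := (\int[mu]_(x in D) ((1 - w x) * phi x)%:E)%E.
set I2 := (\int[mu]_(x in D) (w x * phi x)%:E)%E.
have phiI : (\int[mu]_(x in D) (phi x)%:E)%E = (I1 + I2)%E.
  rewrite /I1 /I2 -ge0_integralD//; do ?[exact/measurable_EFinP|by move=> x Dx; rewrite lee_fin ?p1 ?p2].
  by apply: eq_integral => x _; rewrite -EFinD -mulrDl subrK mul1r.
have vF : (\int[mu]_(x in D) (v x)%:E + I1 <= \int[mu]_(x in D) F x)%E.
  rewrite /I1 -ge0_integralD//; do ?[exact/measurable_EFinP|by move=> x Dx; rewrite lee_fin ?p1// ?v0].
  apply: lower_integral_mono => // x Dx; first by rewrite adde_ge0// lee_fin ?p1// ?v0.
  have -> : F x = ((w x)%:E * F x + (1 - w x)%:E * F x)%E.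
    by rewrite -ge0_muleDl ?lee_fin ?w0 ?w1// -EFinD subrKC mul1e.
  apply: leeD; first exact: vwF.
  by rewrite EFinM lee_wpmul2l ?lee_fin ?w1// phiF.
have I1fin : I1 \is a fin_num.
  rewrite ge0_fin_numE; last by apply: integral_ge0 => x Dx; rewrite lee_fin p1.
  apply: le_lt_trans Foo; apply: le_trans vF; rewrite leeDr//.
  by apply: integral_ge0 => x Dx; rewrite lee_fin v0.
have : (\int[mu]_(x in D) (v x)%:E + I1 <= eps%:E + I2 + I1)%E.
  have -> : (eps%:E + I2 + I1 = eps%:E + (I1 + I2))%E.
    by rewrite addeAC [RHS](addeA eps%:E I1 I2).
  by rewrite -phiI (le_trans vF).
rewrite leeD2rE// => /le_trans; apply; rewrite leeD2l//.
have -> : (C%:E * \int[mu]_(x in D) (w x)%:E = \int[mu]_(x in D) (C%:E * (w x)%:E))%E.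
  by rewrite ge0_integralZl ?lee_fin//; exact/measurable_EFinP.
apply: lower_integral_mono => // x Dx; rewrite lee_fin ?p2//.
by rewrite mulrC ler_wpM2r// w0.
Qed.

(** Lower integrals are not subadditive, but a measurable summand [a] can be
    split off: if [g <= a + H], then the measurable function [max (g - a) 0] is
    a minorant of [H]. *)
Lemma lower_integral_le_add D (G H : T -> \bar R) (a : T -> R) : measurable D ->
  measurable_fun D a -> (forall x, D x -> 0 <= a x) ->
  (forall x, D x -> 0 <= G x)%E -> (forall x, D x -> 0 <= H x)%E ->
  (forall x, D x -> G x <= (a x)%:E + H x)%E ->
  (\int[mu]_(x in D) G x <=
   \int[mu]_(x in D) (a x)%:E + \int[mu]_(x in D) H x)%E.
Proof.
move=> mD ma a0 G0 H0 GaH; apply: lower_integral_le => // g mgT g0 gG.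
have mg : measurable_fun D g by exact: measurable_funTS.
pose v x := Num.max (g x - a x) 0.
have mv : measurable_fun D v.
  by apply: measurable_maxr => //; exact: measurable_funB.
have v0 x : 0 <= v x by rewrite /v le_max lexx orbT.
have vH x : D x -> ((v x)%:E <= H x)%E.
  move=> Dx; rewrite /v EFin_max ge_max H0// andbT.
  by rewrite EFinB leeBlDl// (le_trans (gG x Dx))// GaH.
apply: (@le_trans _ _ (\int[mu]_(x in D) ((a x)%:E + (v x)%:E))%E).
  apply: lower_integral_mono => // x Dx; first by rewrite lee_fin.
  by rewrite -EFinD lee_fin -lerBlDl /v le_max lexx.
rewrite ge0_integralD//;
  do ?[exact/measurable_EFinP|by move=> x Dx; rewrite lee_fin ?a0].
by rewrite leeD2l//; apply: lower_integral_mono => // x _; rewrite lee_fin.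
Qed.

Lemma lower_integralZ_le D F (c : R) : measurable D ->
  (forall x, D x -> 0 <= F x)%E -> 0 < c ->
  (\int[mu]_(x in D) (c%:E * F x) <= c%:E * \int[mu]_(x in D) F x)%E.
Proof.
move=> mD F0 c0; apply: lower_integral_le => //.
  by move=> x Dx; rewrite mule_ge0 ?F0// lee_fin ltW.
move=> g mgT g0 gF.
have mg : measurable_fun D (fun x => c^-1 * g x).
  by apply: measurable_funM => //; exact: measurable_funTS.
have -> : (\int[mu]_(x in D) (g x)%:E =
           \int[mu]_(x in D) (c%:E * (c^-1 * g x)%R%:E))%E.
  by apply: eq_integral => x _; rewrite -EFinM mulVKf// gt_eqF.
rewrite ge0_integralZl//; last by rewrite lee_fin ltW.
- rewrite lee_pmul2l ?lte_fin//; apply: lower_integral_mono => // x Dx.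
    by rewrite lee_fin mulr_ge0// invr_ge0 ltW.
  by rewrite -(@lee_pmul2l _ c%:E) ?lte_fin// -EFinM mulVKf ?gF// gt_eqF.
- exact/measurable_EFinP.
- by move=> x Dx; rewrite lee_fin mulr_ge0// invr_ge0 ltW.
Qed.

End LowerIntegral.

Section PowerIntegral.
Variable R : realType.

Lemma integral_exprn01 n :
  (\int[@lebesgue_measure R]_(x in `]0%R, 1%R[) (x ^+ n)%R%:E = (n.+1%:R^-1)%R%:E)%E.
Proof.
rewrite -(@integral_itv_bndoo _ _ _ _ true false); last first.
  apply/measurable_EFinP; apply: measurable_funTS; exact: exprn_measurable.
rewrite (@continuous_FTC2 _ _ (fun x => n.+1%:R^-1 * x ^+ n.+1))//=.
- by rewrite expr1n mulr1 expr0n/= mulr0 sube0.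
- by apply: continuous_in_subspaceT => x _; exact: exprn_continuous.
- split.
  + by move=> x _; apply: derivableM => //; exact: exprn_derivable.
  + apply: cvg_at_right_filter; apply: cvgM; [exact: cvg_cst|exact: exprn_continuous].
  + apply: cvg_at_left_filter; apply: cvgM; [exact: cvg_cst|exact: exprn_continuous].
- move=> x _; rewrite derive1Ml; last exact: exprn_derivable.
  by rewrite derive1E exp_derive /GRing.scale/= mulr1 mulKf// pnatr_eq0.
Qed.

End PowerIntegral.

(** * Increments and the integral of the speed *)

Section Speed.
Variables (R : realType) (V : normedModType R[i]).
Implicit Types (u : R -> V) (v : R -> R).

(** Continuous induction: the set of [t] with [|u t - u a| <= G t] is closed
    under suprema, by left continuity of [u] and monotonicity of [G], and none of
    its elements below [b] is its maximum. *)
Lemma rnorm_increment_le_majorant u (G : R -> \bar R) (a b : R) : a <= b ->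
  (forall s t, a <= s -> s <= t -> t <= b -> (G s <= G t)%E) ->
  (0 <= G a)%E ->
  (forall t, a <= t -> t < b -> exists2 d, 0 < d &
     forall h, 0 < h -> h < d -> t + h <= b ->
     ((rnorm (u (t + h)%R - u t)%R)%:E + G t <= G (t + h)%R)%E) ->
  (forall t, a < t -> t <= b -> forall e, 0 < e -> exists2 d, 0 < d &
     forall s, t - d < s -> s < t -> rnorm (u t - u s) <= e) ->
  ((rnorm (u b - u a)%R)%:E <= G b)%E.
Proof.
move=> ab Gmono Ga0 Gstep ucont.
pose S := [set t | a <= t <= b /\ ((rnorm (u t - u a)%R)%:E <= G t)%E].
have Sa : S a by split; rewrite ?lexx// subrr rnorm0.
have hS : has_sup S.
  by split; [exists a|exists b => t [/andP[]]].
set s := sup S.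
have as_ : a <= s by apply: ub_le_sup => //; exact: hS.2.
have sb : s <= b by apply: ge_sup => //; [exists a|move=> t [/andP[]]].
have Ss : S s.
  split; first by rewrite as_ sb.
  have [->|sa] := eqVneq s a; first exact: Sa.2.
  have {}as_ : a < s by rewrite lt_neqAle eq_sym sa.
  apply/lee_addgt0Pr => e e0.
  have [d d0 du] := ucont s as_ sb _ e0.
  have [t [/andP[at_ tb] tG] dt] := sup_adherent d0 hS.
  have : t <= s by apply: ub_le_sup; [exact: hS.2|split; rewrite ?at_].
  rewrite le_eqVlt => /predU1P[ts|ts].
    by rewrite -ts (le_trans tG)// leeDl// lee_fin ltW.
  rewrite (@le_trans _ _ ((rnorm (u t - u a)%R)%:E + e%:E)%E)//.
    rewrite -EFinD lee_fin [leRHS]addrC.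
    by rewrite (le_trans (ler_rnormB _ (u t) _))// lerD2r du.
  by apply: leeD => //; apply: (le_trans tG); apply: Gmono => //; exact: ltW.
have [<-|sb'] := eqVneq s b; first exact: Ss.2.
have {}sb' : s < b by rewrite lt_neqAle sb'.
have [d d0 dG] := Gstep s as_ sb'.
pose h := Num.min (d / 2) (b - s).
have h0 : 0 < h by rewrite lt_min divr_gt0//= subr_gt0.
have hd : h < d by rewrite gt_min ltr_pdivrMr// ltr_pMr// ltr1n.
have shb : s + h <= b by rewrite -lerBrDl ge_min lexx orbT.
have : S (s + h).
  split; first by rewrite shb (le_trans as_)//= lerDl ltW.
  apply: le_trans (dG h h0 hd shb).
  apply: (@le_trans _ _ ((rnorm (u (s + h)%R - u s)%R)%:E + (rnorm (u s - u a)%R)%:E)%E).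
    by rewrite -EFinD lee_fin ler_rnormB.
  by apply: leeD => //; exact: Ss.2.
by move=> /(ub_le_sup hS.2); rewrite -/s leNgt ltrDl h0.
Qed.

Local Notation lambda := (@lebesgue_measure R).

Lemma lambda_itvcc (a b : R) : a <= b -> lambda `[a, b]%classic = (b - a)%:E.
Proof.
move=> ab; rewrite lebesgue_measure_itv/= lte_fin; case: ltP => // ba.
by rewrite (@le_anti _ _ a b) ?ab// subrr.
Qed.

(** Cut [[a, b]] into the sets [A k] where [k eps <= v < (k + 1) eps], and cover
    each [A k] by an open set [W k] of nearly the same measure.  The sum
    [G x] of the [(k + 1) eps lambda (W k /\ [a, x])] grows at rate at least
    [(k + 1) eps > v t] to the right of any [t] in [A k], since [W k] is open; it
    therefore majorizes the increments of [u], while [G b] is close to the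
    integral of [v]. *)
Lemma rnorm_increment_le_eps u v (a b eps : R) : a <= b -> 0 < eps ->
  measurable_fun `[a, b] v -> (forall t, a <= t <= b -> 0 <= v t) ->
  (forall t, a <= t -> t < b -> forall e, 0 < e -> exists2 d, 0 < d &
     forall h, 0 < h -> h < d -> rnorm (u (t + h) - u t) <= (v t + e) * h) ->
  (forall t, a < t -> t <= b -> forall e, 0 < e -> exists2 d, 0 < d &
     forall s, t - d < s -> s < t -> rnorm (u t - u s) <= e) ->
  ((rnorm (u b - u a)%R)%:E <=
   \int[lambda]_(x in `[a, b]) (v x + eps)%R%:E + eps%:E)%E.
Proof.
move=> ab eps0 mv v0 uspeed ucont.
pose c k : R := k.+1%:R * eps.
have c0 k : 0 < c k by rewrite mulr_gt0.
pose A k := `[a, b]%classic `&` v @^-1` `[k%:R * eps, c k[%classic.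
have mA k : measurable (A k) by apply: mv => //; exact: measurable_itv.
have Ab k : A k `<=` `[a, b]%classic by exact: subIsetl.
have lamab := lambda_itvcc ab.
have lamle (B C : set R) : measurable B -> measurable C -> B `<=` C ->
    (lambda B <= lambda C)%E.
  by move=> mB mC BC; apply: (@le_measure _ _ _ lambda); rewrite ?inE.
have lamU2 (B C : set R) : measurable B -> measurable C ->
    (lambda (B `|` C) <= lambda B + lambda C)%E.
  by move=> mB mC; exact: (@measureU2 _ _ _ lambda).
have lamU (B C : set R) : measurable B -> measurable C -> B `&` C = set0 ->
    (lambda (B `|` C) = lambda B + lambda C)%E.
  by move=> mB mC BC; exact: (@measureU _ _ _ lambda).
have Afin k : (lambda (A k) < +oo)%E.
  apply: (@le_lt_trans _ _ (lambda `[a, b]%classic)); last by rewrite lamab ltry.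
  apply: lamle (Ab k); [exact: mA|exact: measurable_itv].
have dk0 k : 0 < eps / (2 ^ k.+1)%:R / c k by rewrite !divr_gt0// ltr0n expn_gt0.
have /choice[W WA] : forall k, exists U : set R,
    [/\ open U, A k `<=` U & (lambda (U `\` A k) < (eps / (2 ^ k.+1)%:R / c k)%R%:E)%E].
  by move=> k; have := lebesgue_regularity_outer (mA k) (Afin k) (dk0 k).
have mO k : measurable (W k) by apply: open_measurable; have [] := WA k.
pose G x := (\sum_(k <oo) (c k)%:E * lambda (W k `&` `[a, x]))%E.
have mOx k x : measurable (W k `&` `[a, x]) by exact: measurableI.
have G0 x k : (0 <= (c k)%:E * lambda (W k `&` `[a, x]))%E.
  by rewrite mule_ge0// lee_fin ltW.
have trivA : trivIset setT A.
  apply/trivIsetP => i j _ _ ij; apply/seteqP; split => // t [[_ /=]].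
  rewrite in_itv/= => /andP[it ti] [_ /=]; rewrite in_itv/= => /andP[jt tj].
  have := le_lt_trans it tj; have := le_lt_trans jt ti.
  rewrite !ltr_pM2r// !ltr_nat !ltnS => ji ij'.
  by move: ij; rewrite eqn_leq ij' ji.
have coverA : \bigcup_k A k = `[a, b]%classic.
  apply/seteqP; split => [t [k _ /Ab]//|t abt].
  have vt0 : 0 <= v t / eps.
    by apply: divr_ge0; [apply: v0; move: abt; rewrite /= in_itv|exact: ltW].
  exists (Num.truncn (v t / eps)) => //; split => //=; rewrite in_itv/=.
  by rewrite -ler_pdivlMr// truncn_le vt0 /c -ltr_pdivrMr// truncnS_gt.
apply: (@le_trans _ _ (G b)); last first.
  apply: (@le_trans _ _ (\sum_(k <oo) ((c k)%:E * lambda (A k) + (eps / (2 ^ k.+1)%:R)%R%:E))%E).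
    apply: lee_nneseries => [k _ _|k _]; first exact: G0.
    have [_ AO OAk] := WA k.
    apply: (@le_trans _ _ ((c k)%:E * (lambda (A k) + lambda (W k `\` A k)))%E).
      rewrite lee_pmul2l ?lte_fin//.
      apply: (@le_trans _ _ (lambda (W k))).
        by apply: lamle => //; exact: subIsetl.
      rewrite -[in leLHS](setDUK AO); apply: lamU2 => //.
      exact: measurableD.
    rewrite ge0_muleDr// leeD2l//.
    have -> : (eps / (2 ^ k.+1)%:R)%R%:E = ((c k)%:E * (eps / (2 ^ k.+1)%:R / c k)%R%:E)%E.
      by rewrite -EFinM; congr EFin; rewrite [RHS]mulrC divfK// gt_eqF.
    by apply: lee_wpmul2l; [rewrite lee_fin ltW|exact: ltW].
  apply: (le_trans (epsilon_trick _ _ _)) => //.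
  - by move=> k; rewrite mule_ge0// lee_fin ltW.
  - exact: ltW.
  rewrite leeD2r// -coverA (ge0_integral_bigcup lambda mA)//; last 2 first.
  - by rewrite coverA; apply/measurable_EFinP; apply: measurable_funD.
  - by rewrite coverA => x /=; rewrite in_itv/= => /v0 ?; rewrite lee_fin addr_ge0// ltW.
  apply: lee_nneseries => [k _ _|k _].
    by rewrite mule_ge0// lee_fin ltW.
  rewrite -(integral_cst lambda (mA k)); 
  apply: (@lower_integral_mono _ _ _ lambda _ _ _ (mA k)) => x.
    by move=> _; rewrite lee_fin ltW.
  move=> [_/=]; rewrite in_itv/= => /andP[kv _].
  by rewrite lee_fin /c -natr1 mulrDl mul1r lerD2r.
apply: rnorm_increment_le_majorant => //.
- move=> s t as_ st tb; apply: lee_nneseries => [k _ _|k _]; first exact: G0.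
  rewrite lee_pmul2l ?lte_fin//; apply: lamle => //.
  by apply: setIS => x/=; rewrite !in_itv/= => /andP[-> /le_trans->].
- exact: nneseries_ge0.
- move=> t at_ tb.
  have : (\bigcup_k A k) t by rewrite coverA/= in_itv/= at_ ltW.
  move=> [k _ Akt]; have [oO AO _] := WA k.
  have := oO t (AO _ Akt) => /nbhs_ballP[d1 /= d10 d1O].
  have ckv : 0 < c k - v t.
    by move: Akt => [_ /=]; rewrite in_itv/= subr_gt0 => /andP[].
  have [d2 d20 d2u] := uspeed t at_ tb (c k - v t) ckv.
  exists (Num.min d1 d2); first by rewrite lt_min d10.
  move=> h h0; rewrite lt_min => /andP[hd1 hd2] thb.
  pose B j := ((c j)%:E * lambda (W j `&` `]t, (t + h)%R]%classic))%E.
  have mOh j : measurable (W j `&` `]t, (t + h)%R]%classic) by exact: measurableI.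
  have B0 j : (0 <= B j)%E by rewrite mule_ge0// lee_fin ltW.
  have -> : G (t + h) = (G t + \sum_(j <oo) B j)%E.
    rewrite /G -nneseriesD//; apply: eq_eseriesr => j _.
    rewrite /B -ge0_muleDr//; congr (_ * _)%E.
    rewrite -lamU//.
      rewrite -setIUr; congr (lambda (_ `&` _)); apply/seteqP; split => x /=.
        rewrite !in_itv/= => /andP[ax xth]; have [xt|tx] := leP x t.
          by left; rewrite ax.
        by right.
      rewrite !in_itv/= => -[/andP[-> xt]|/andP[tx ->]].
        by rewrite (le_trans xt)// lerDl ltW.
      by rewrite (le_trans at_ (ltW tx)).
    apply/seteqP; split => x //= [[_]]; rewrite in_itv/= => /andP[_ xt] [_].
    by rewrite in_itv/= ltNge xt.
  rewrite addeC; apply: leeD => //.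
  rewrite (nneseriesD1 (n := k))//.
  apply: (@le_trans _ _ (B k)); last by rewrite leeDl// nneseries_ge0.
  have -> : B k = (c k * h)%:E.
    rewrite /B (_ : _ `&` _ = `]t, (t + h)%R]%classic).
      rewrite lebesgue_measure_itv/= lte_fin ltrDl h0 -EFinB -EFinM.
      by rewrite addrAC subrr add0r.
    rewrite setIC; apply/setIidPl => x/=; rewrite in_itv/= => /andP[tx xth].
    apply: d1O; rewrite /ball/= ltr_distlC; apply/andP; split; lra.
  rewrite lee_fin (le_trans (d2u _ h0 hd2))//.
  by rewrite addrC subrK.
Qed.

(** The hard half of the fundamental theorem of calculus: the two error terms
    of the previous bound are linear in [eps]. *)
Lemma rnorm_increment_le_integral u v (a b : R) : a <= b ->
  measurable_fun `[a, b] v -> (forall t, a <= t <= b -> 0 <= v t) ->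
  (forall t, a <= t -> t < b -> forall e, 0 < e -> exists2 d, 0 < d &
     forall h, 0 < h -> h < d -> rnorm (u (t + h) - u t) <= (v t + e) * h) ->
  (forall t, a < t -> t <= b -> forall e, 0 < e -> exists2 d, 0 < d &
     forall s, t - d < s -> s < t -> rnorm (u t - u s) <= e) ->
  ((rnorm (u b - u a)%R)%:E <= \int[lambda]_(x in `[a, b]) (v x)%:E)%E.
Proof.
move=> ab mv v0 uspeed ucont; apply/lee_addgt0Pr => e e0.
have ba1 : 0 < b - a + 1 by rewrite ltr_pwDr// subr_ge0.
pose eps := e / (b - a + 1).
have eps0 : 0 < eps by rewrite divr_gt0.
apply: (le_trans (rnorm_increment_le_eps ab eps0 mv v0 uspeed ucont)).
have -> : (\int[lambda]_(x in `[a, b]) (v x + eps)%R%:E =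
    \int[lambda]_(x in `[a, b]) (v x)%:E + \int[lambda]_(x in `[a, b]) (cst eps%:E) x)%E.
  rewrite -ge0_integralD//.
  - exact/measurable_EFinP.
  - by move=> x _; rewrite lee_fin ltW.
rewrite (integral_cst lambda (measurable_itv _)) -addeA leeD2l//.
have -> : (e%:E = eps%:E * lambda `[a, b]%classic + eps%:E)%E.
  rewrite lambda_itvcc// -EFinM -EFinD; congr EFin.
  by rewrite -[X in _ + X]mulr1 -mulrDr /eps divfK// gt_eqF.
exact: lexx.
Qed.
End Speed.

(** * Complex derivatives along rays *)

Section Nbhs.
Variables (R : realType).
Local Notation cmod := (@rnorm R R[i]^o).

Lemma nbhs_rnormP (V : normedModType R[i]) (x : V) (P : set V) :
  nbhs x P <-> exists2 d : R, 0 < d & forall y, rnorm (y - x) < d -> P y.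
Proof.
split => [/nbhs_ballP[e /= e0 eP]|[d d0 dP]].
  have eE : e = (complex.Re e)%:C by rewrite RRe_real// gtr0_real.
  exists (complex.Re e); first by rewrite -ltcR -eE.
  move=> y yd; apply: eP; rewrite -ball_normE /ball_/= distrC rnormE eE ltcR//.
apply/nbhs_ballP; exists d%:C; first by rewrite /= ltcR.
by move=> y; rewrite -ball_normE /ball_/= distrC rnormE ltcR => /dP.
Qed.

Lemma cvg_rnormP (V : normedModType R[i]) T (F : set_system T) {FF : Filter F}
    (g : T -> V) (l : V) :
  g x @[x --> F] --> l <->
  forall e : R, 0 < e -> \forall x \near F, rnorm (g x - l) < e.
Proof.
split => [gl e e0|gl A /nbhs_rnormP[d d0 dA]].
  by apply: (gl [set y | rnorm (y - l) < e]); apply/nbhs_rnormP; exists e.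
by apply: filterS (gl d d0) => x /dA.
Qed.

(** The form in which a complex derivative restricts to a ray. *)
Lemma derive1_epsP (f : R[i]^o -> R[i]^o) z : derivable f z 1 ->
  forall e, 0 < e -> exists2 d, 0 < d & forall k : R[i]^o, cmod k < d ->
  cmod (f (z + k) - f z - derive1 f z * k) <= e * cmod k.
Proof.
move=> fz e e0.
have fz' : h^-1 *: (f (h + z) - f z) @[h --> (0 : R[i]^o)^'] --> derive1 f z.
  suff : cvg (h^-1 *: (f (h + z) - f z) @[h --> (0 : R[i]^o)^']) by [].
  move: fz; rewrite /derivable.
  by under eq_fun do rewrite /= /GRing.scale/= mulr1.
have /cvg_rnormP/(_ e e0) := fz'; move=> /nbhs_rnormP[d d0 dP].
exists d => // k kd; have [->|k0] := eqVneq k 0.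
  by rewrite addr0 subrr mulr0 subr0 rnorm0 mulr0.
have := dP k; rewrite subr0 => /(_ kd k0) /ltW le_e.
have ck0 : 0 < cmod k.
  by rewrite lt_neqAle rnorm_ge0 andbT eq_sym; apply: contra_neq k0; exact: rnorm_eq0.
have -> : f (z + k) - f z - derive1 f z * k =
    (k^-1 *: (f (k + z) - f z) - derive1 f z) * k.
  by rewrite mulrBl /GRing.scale/= mulrAC mulVf// mul1r [k + z]addrC.
by rewrite rnormM ler_pM2r.
Qed.
End Nbhs.

Section RadialSpeed.
Variables (R : realType) (f : R[i]^o -> R[i]^o).
Local Notation cmod := (@rnorm R R[i]^o).
Hypothesis f_holo : holomorphic_on_disc f.

Lemma holomorphic_continuous z : disc z -> forall e, 0 < e ->
  exists2 d, 0 < d & forall k : R[i]^o, cmod k < d -> cmod (f (z + k) - f z) <= e.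
Proof.
move=> /f_holo/derive1_epsP/(_ _ ltr01)[d d0 dP] e e0.
pose c := cmod (derive1 f z) + 1.
have c0 : 0 < c by rewrite ltr_wpDl// rnorm_ge0.
exists (Num.min d (e / c)); first by rewrite lt_min d0 divr_gt0.
move=> k; rewrite lt_min => /andP[/dP kd kec].
rewrite -[_ - _](subrK (derive1 f z * k)) (le_trans (ler_rnormD _ _))//.
rewrite (le_trans (lerD kd (lexx _)))// rnormM -mulrDl addrC -/c mulrC.
by rewrite -ler_pdivlMr// ltW.
Qed.

Lemma radial_step (r t : R) : `|r| < 1 -> forall e, 0 < e ->
  exists2 d, 0 < d & forall h, `|h| < d ->
  `|cmod (f (polar (r + h) t) - f (polar r t)) -
    cmod (derive1 f (polar r t)) * `|h| | <= e * `|h|.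
Proof.
move=> r1 e e0; have fz : derivable f (polar r t) 1 by apply: f_holo; rewrite disc_polar.
have [d d0 dP] := derive1_epsP fz e0; exists d => // h hd.
have := dP (polar h t); rewrite cmod_polar -polarD => /(_ hd) {}dP.
by rewrite -{1}(cmod_polar h t) -rnormM (le_trans (ler_dist_rnorm _ _)).
Qed.

(** A pointwise limit of difference quotients with steps [-1 / (n + 2)], which
    keep the base point [r - 1 / (n + 2)] inside [(-1, 1)]. *)
Lemma measurable_radial_speed (t : R) :
  measurable_fun (`]0, 1[%classic : set R) (fun r : R => cmod (derive1 f (polar r t))).
Proof.
pose F n (r : R) := n.+2%:R * cmod (f (polar (r - n.+2%:R^-1) t) - f (polar r t)).
have n2 n : 0 < n.+2%:R^-1 :> R by rewrite invr_gt0.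
have n2' n : n.+2%:R^-1 < 1 :> R by rewrite invf_lt1// ltr1n.
apply: (@measurable_fun_cvg _ _ _ _ F).
  move=> n; apply: open_continuous_measurable_fun; first exact: itv_open.
  move=> r; rewrite inE/= in_itv/= => /andP[r0 r1].
  apply: cvgM; first exact: cvg_cst.
  apply/cvgrPdist_le => e e0.
  have e2 : 0 < e / 2 by rewrite divr_gt0.
  have := n2 n; have := n2' n; set a := n.+2%:R^-1 => a1 a0.
  have [] := @holomorphic_continuous (polar (r - a) t) _ _ e2.
    rewrite disc_polar ltr_norml; apply/andP; split; lra.
  move=> d1 d10 d1P.
  have [] := @holomorphic_continuous (polar r t) _ _ e2.
    rewrite disc_polar ltr_norml; apply/andP; split; lra.
  move=> d2 d20 d2P.
  have d0 : 0 < Num.min d1 d2 by rewrite lt_min d10.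
  near=> s; have : `|s - r| < Num.min d1 d2.
    near: s; apply/nbhs_ballP; exists (Num.min d1 d2) => // s.
    by rewrite /ball/= distrC.
  rewrite lt_min => /andP[sd1 sd2].
  rewrite distrC (le_trans (ler_dist_rnorm _ _))//.
  have -> : polar (s - a) t = polar (r - a) t + polar (s - r) t.
    by rewrite -polarD; congr polar; lra.
  have -> : polar s t = polar r t + polar (s - r) t.
    by rewrite -polarD; congr polar; lra.
  have BE (x y z w : R[i]^o) : (x - y) - (z - w) = (x - z) - (y - w).
    by rewrite !opprB addrACA [RHS]addrACA [- y - z]addrC.
  rewrite BE (splitr e) (le_trans (ler_rnormD _ _))// rnormN lerD//.
    by apply: d1P; rewrite cmod_polar.
  by apply: d2P; rewrite cmod_polar.
move=> r /=; rewrite in_itv/= => /andP[r0 r1].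
apply/cvgrPdist_le => e e0.
have [] := @radial_step r t _ e e0.
  by rewrite gtr0_norm.
move=> d d0 dP.
near=> n.
have := dP (- n.+2%:R^-1); rewrite normrN gtr0_norm// => /(_ _).
have nd : n.+2%:R^-1 < d.
  rewrite invf_plt ?posrE// (lt_trans (truncnS_gt _))// ltr_nat.
  by rewrite ltnS ltnS; near: n; exact: nbhs_infty_ge.
move=> /(_ nd); rewrite -(ler_pM2l (ltr0Sn R n.+1)) /F.
rewrite mulrCA mulfV// mulr1 -[X in X * `|_|]gtr0_norm// -normrM mulrBr.
by rewrite mulrCA mulfV// mulr1 distrC.
Unshelve. all: by end_near. Qed.

End RadialSpeed.

(** * Radial estimates in B(D) *)

Section BFunctions.
Variables (R : realType).
Local Notation cmod := (@rnorm R R[i]^o).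
Local Notation lambda := (@lebesgue_measure R).
Implicit Types (f g h : R[i]^o -> R[i]^o).

Definition max_speed f (r : R) : \bar R :=
  ereal_sup [set (cmod (derive1 f (polar r t)))%:E | t in `[(- pi)%R, pi]].

Lemma B0normE f : B0norm f = (\int[lambda]_(r in `]0%R, 1%R[) max_speed f r)%E.
Proof. by []. Qed.

Lemma le_max_speed f (r t : R) : t \in `[(- pi)%R, pi] ->
  ((cmod (derive1 f (polar r t)))%:E <= max_speed f r)%E.
Proof. by move=> tpi; apply: ereal_sup_ubound; exists t. Qed.

Lemma max_speed_ge0 f (r : R) : (0 <= max_speed f r)%E.
Proof.
apply: le_trans (@le_max_speed f r 0 _); first by rewrite lee_fin rnorm_ge0.
by rewrite in_itv/= oppr_le0 !pi_ge0.
Qed.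

Lemma max_speed_le f (r : R) (A : \bar R) :
  (forall z : R[i]^o, cmod z = `|r| -> ((cmod (derive1 f z))%:E <= A)%E) ->
  (max_speed f r <= A)%E.
Proof.
move=> fA; apply: ge_ereal_sup => _ [t _ <-]; apply: fA.
by rewrite cmod_polar.
Qed.

Lemma radial_increment f (a b t : R) : holomorphic_on_disc f ->
  0 < a -> a <= b -> b < 1 ->
  ((cmod (f (polar b t) - f (polar a t))%R)%:E <=
   \int[lambda]_(r in `[a, b]) (cmod (derive1 f (polar r t)))%:E)%E.
Proof.
move=> fh a0 ab b1.
have n1 r : a <= r -> r <= b -> `|r| < 1.
  by move=> ar rb; rewrite ger0_norm ?(le_lt_trans rb)// (le_trans (ltW a0)).
apply: (@rnorm_increment_le_integral R R[i]^o (fun r => f (polar r t)) _ a b ab).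
- apply: (measurable_funS _ _ (measurable_radial_speed fh t)).
    exact: measurable_itv.
  by move=> r/=; rewrite !in_itv/= => /andP[/(lt_le_trans a0)-> /le_lt_trans->].
- by move=> r _; exact: rnorm_ge0.
- move=> r ar rb e e0; have [] := @radial_step _ _ fh r t _ e e0.
    by apply: n1 => //; exact: ltW.
  move=> d d0 dP; exists d => // k k0 kd; have := dP k.
  rewrite gtr0_norm// => /(_ kd) /(le_trans (ler_norm _)).
  by rewrite lerBlDr -mulrDl [e + _]addrC.
- move=> r ar rb e e0.
  have [] := @holomorphic_continuous _ _ fh (polar r t) _ e e0.
    by rewrite disc_polar n1// ltW.
  move=> d d0 dP; exists d => // s rs sr; rewrite rnormB.
  have := dP (polar (s - r) t); rewrite -polarD cmod_polar.
  rewrite (_ : r + (s - r) = s); last by lra.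
  by apply; rewrite distrC gtr0_norm ?subr_gt0//; lra.
Qed.

Lemma radial_increment_le f (a b t : R) : holomorphic_on_disc f ->
  t \in `[(- pi)%R, pi] -> 0 < a -> a <= b -> b < 1 ->
  ((cmod (f (polar b t) - f (polar a t))%R)%:E <=
   \int[lambda]_(r in `]0%R, 1%R[) ((\1_(`[a, b]%classic) r)%:E * max_speed f r))%E.
Proof.
move=> fh tpi a0 ab b1; apply: (le_trans (radial_increment t fh a0 ab b1)).
rewrite integral_mkcond [leRHS]integral_mkcond.
apply: (@lower_integral_mono _ _ _ lambda _ _ _ (@measurableT _ _)) => r _.
  by rewrite patchE; case: ifPn => // _; rewrite lee_fin rnorm_ge0.
rewrite !patchE; case: ifPn => [|_]; last first.
  by case: ifPn => // _; rewrite mule_ge0 ?max_speed_ge0// lee_fin.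
rewrite inE => abr; rewrite mem_set; last first.
  by move: abr; rewrite /= !in_itv/= => /andP[/(lt_le_trans a0)-> /le_lt_trans->].
by rewrite indicE mem_set// mul1e le_max_speed.
Qed.

(** The weight [1_[a, b]] turns the integrability of [max_speed f] into a bound
    that depends on [1 - r0] only, hence is uniform over all rays. *)
Lemma radial_uniformly_cauchy f : inB f -> forall e, 0 < e ->
  exists2 r0, 0 < r0 < 1 & forall a b t, t \in `[(- pi)%R, pi] ->
  r0 <= a -> a <= b -> b < 1 -> cmod (f (polar b t) - f (polar a t)) <= e.
Proof.
move=> [fh fB] e e0; have e2 : 0 < e / 2 by rewrite divr_gt0.
rewrite B0normE in fB.
have [C C0 CP] := @lower_integral_weight _ _ _ lambda _ _ _ (measurable_itv _)
  (fun r _ => max_speed_ge0 f r) fB e2.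
pose d := Num.min (1 / 2) (e / 2 / (C + 1)).
have C1 : 0 < C + 1 by rewrite ltr_wpDl.
have d0 : 0 < d by rewrite lt_min divr_gt0//= divr_gt0.
have dle : d <= 1 / 2 by rewrite ge_min lexx.
exists (1 - d); first by apply/andP; split; lra.
move=> a b t tpi ra ab b1; rewrite -lee_fin.
have a0 : 0 < a by lra.
apply: (le_trans (radial_increment_le fh tpi a0 ab b1)).
apply: (le_trans (CP _ _ _)).
- exact: measurable_indic.
- by move=> r _; rewrite indicE; case: (_ \in _); rewrite ?lexx ?ler01.
rewrite integral_indic// setIidl; last first.
  by move=> r/=; rewrite !in_itv/= => /andP[/(lt_le_trans a0)-> /le_lt_trans->].
rewrite [X in (_ * X)%E](_ : _ = (b - a)%:E); last exact: lambda_itvcc.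
rewrite -EFinM -EFinD lee_fin.
have : C * (b - a) <= C * d by rewrite ler_wpM2l//; lra.
have : (C + 1) * d <= e / 2.
  by rewrite mulrC -ler_pdivlMr// ge_min lexx orbT.
nra.
Qed.

(** Any point is joined to a neighbourhood of [0] by a radius, along which [f]
    moves by at most [B0norm f]. *)
Lemma inB_bounded f : inB f -> exists2 K, 0 < K & forall z, disc z -> cmod (f z) <= K.
Proof.
move=> [fh fB].
pose K := cmod (f 0) + 1 + fine (B0norm f).
have B0fin : B0norm f \is a fin_num.
  by rewrite ge0_fin_numE// B0normE integral_ge0// => r _; exact: max_speed_ge0.
have B00 : 0 <= fine (B0norm f).
  by rewrite fine_ge0// B0normE integral_ge0// => r _; exact: max_speed_ge0.
exists K; first by rewrite /K; have := rnorm_ge0 (f 0); lra.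
move=> z; rewrite discE => z1.
have [->|z0] := eqVneq z 0; first by rewrite /K; lra.
have [t tpi zE] := polar_surj z.
have zgt0 : 0 < cmod z.
  by rewrite lt_neqAle rnorm_ge0 andbT eq_sym; apply: contra_neq z0; exact: rnorm_eq0.
have [] := @holomorphic_continuous _ _ fh 0 _ 1 ltr01.
  by rewrite discE rnorm0.
move=> d d0 dP.
pose a := Num.min (cmod z) (d / 2).
have a0 : 0 < a by rewrite lt_min zgt0 divr_gt0.
have az : a <= cmod z by rewrite ge_min lexx.
have ad : a < d by rewrite gt_min; apply/orP; right; lra.
have := dP (polar a t); rewrite add0r cmod_polar gtr0_norm// => /(_ ad) h1.
have h2 : cmod (f z - f (polar a t)) <= fine (B0norm f).
  rewrite -lee_fin fineK// {1}zE.
  apply: (le_trans (radial_increment_le fh tpi a0 az z1)).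
  rewrite B0normE; apply: lower_integral_mono => // r _.
    by rewrite mule_ge0// ?max_speed_ge0// lee_fin.
  rewrite -[leRHS]mul1e lee_wpmul2r ?max_speed_ge0// lee_fin indicE.
  by case: (_ \in _); rewrite ?lexx ?ler01.
have -> : f z = (f z - f (polar a t)) + ((f (polar a t) - f 0) + f 0).
  by rewrite !subrK.
have := ler_rnormD (f z - f (polar a t)) ((f (polar a t) - f 0) + f 0).
have := ler_rnormD (f (polar a t) - f 0) (f 0).
rewrite /K; lra.
Qed.

End BFunctions.

(** * Boundary values *)

Section Boundary.
Variables (R : realType).
Local Notation cmod := (@rnorm R R[i]^o).
Implicit Types (f g h : R[i]^o -> R[i]^o).

(** A point [z] close to [z0] is pulled back radially to [z'] with
    [|z'| = r0]: this changes [f] little, uniformly in [z], and [z'] is close to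
    [r0 z0], where [f] is continuous. *)
Lemma boundary_oscillation f (z0 : R[i]^o) : inB f -> cmod z0 = 1 ->
  forall e, 0 < e -> exists c : R[i]^o, exists2 d, 0 < d &
  forall z, disc z -> cmod (z - z0) < d -> cmod (f z - c) <= e.
Proof.
move=> fB z01 e e0; have e2 : 0 < e / 2 by rewrite divr_gt0.
have [r0 /andP[r00 r01] r0P] := radial_uniformly_cauchy fB e2.
exists (f (r0%:C * z0)).
have [] := @holomorphic_continuous _ _ fB.1 (r0%:C * z0) _ _ e2.
  by rewrite discE rnormM z01 mulr1 rnorm_real gtr0_norm.
move=> d1 d10 d1P.
exists (Num.min (1 - r0) (d1 / 2)).
  by rewrite lt_min subr_gt0 r01/= divr_gt0.
move=> z; rewrite discE lt_min => z1 /andP[zr zd].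
have [t tpi zE] := polar_surj z.
have hz : 1 - cmod z <= cmod (z - z0).
  by have := ler_dist_rnorm z0 z; rewrite z01 rnormB => /(le_trans (ler_norm _)).
have rz : r0 <= cmod z by lra.
have := r0P r0 (cmod z) t tpi (lexx _) rz z1; rewrite -zE => h1.
have h2 : cmod (polar r0 t - r0%:C * z0) < d1.
  have -> : polar r0 t = r0%:C * polar 1 t by rewrite -polarM mulr1.
  rewrite -mulrBr rnormM rnorm_real gtr0_norm//.
  have h3 : cmod (polar 1 t - z) = 1 - cmod z.
    by rewrite {1}zE -polarNr -polarD cmod_polar ger0_norm// subr_ge0 ltW.
  have h4 := @ler_rnormB _ R[i]^o (polar 1 t) z z0.
  have := rnorm_ge0 ((polar 1 t : R[i]^o) - z0); nra.
have := d1P _ h2; rewrite subrKC => h5.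
by have := ler_rnormB (f z) (f (polar r0 t)) (f (r0%:C * z0)); lra.
Qed.

Lemma within_disc_proper (z0 : R[i]^o) : cmod z0 = 1 ->
  ProperFilter (within (@disc R) (nbhs z0)).
Proof.
move=> z01; apply: Build_ProperFilter_ex => A.
rewrite /within/= => /nbhs_rnormP[d d0 dA].
pose s := Num.min (1 / 2) (d / 2).
have s0 : 0 < s by rewrite lt_min !divr_gt0.
have s2 : s <= 1 / 2 by rewrite ge_min lexx.
have sd : s < d by rewrite gt_min; apply/orP; right; lra.
exists ((1 - s)%:C * z0); apply: dA.
  have -> : (1 - s)%:C * z0 - z0 = (- s)%:C * z0.
    by rewrite -{2}[z0]mul1r -mulrBl -(rmorph1 (real_complex R)) -rmorphB addrAC subrr add0r.
  by rewrite rnormM z01 mulr1 rnorm_real normrN gtr0_norm.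
by rewrite discE rnormM z01 mulr1 rnorm_real ger0_norm; lra.
Qed.

(** The small oscillation of [f] near [z0] makes its real and imaginary parts
    Cauchy along the filter defining [disc_ext]. *)
Lemma disc_ext_cvg f (z0 : R[i]^o) : inB f -> cmod z0 = 1 ->
  f w @[w --> within (@disc R) (nbhs z0)] --> disc_ext f z0.
Proof.
move=> fB z01; have PF := within_disc_proper z01.
suff : cvg (f w @[w --> within (@disc R) (nbhs z0)]) by [].
have osc (p : R[i] -> R) : (forall x y, p (x - y) = p x - p y) ->
    (forall x, `|p x| <= cmod x) -> cvg (p (f w) @[w --> within (@disc R) (nbhs z0)]).
  move=> pB pn; apply/cauchy_cvgP; apply/cauchy_exP => e e0.
  have e2 : 0 < e / 2 by rewrite divr_gt0.
  have [c [d d0 dP]] := boundary_oscillation fB z01 e2.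
  exists (p c); rewrite /fmap/= /within/=; apply/nbhs_rnormP; exists d => // z zd zD.
  rewrite /= /ball/= distrC -pB (le_lt_trans (pn _))// (le_lt_trans (dP _ zD zd))//.
  by lra.
have /cvg_ex[/= a aP] : cvg (complex.Re (f w) @[w --> within (@disc R) (nbhs z0)]).
  by apply: osc; [case=> ? ? []|exact: ler_Re_cmod].
have /cvg_ex[/= b bP] : cvg (complex.Im (f w) @[w --> within (@disc R) (nbhs z0)]).
  by apply: osc; [case=> ? ? []|exact: ler_Im_cmod].
apply/cvg_ex; exists (a +i* b); apply/cvg_rnormP => e e0.
have e2 : 0 < e / 2 by rewrite divr_gt0.
move/cvgrPdist_lt : aP => /(_ _ e2) aP.
move/cvgrPdist_lt : bP => /(_ _ e2) bP.
near=> w; rewrite (le_lt_trans (ler_cmod_ReIm _))// (splitr e).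
have -> : complex.Re (f w - a +i* b) = complex.Re (f w) - a by case: (f w).
have -> : complex.Im (f w - a +i* b) = complex.Im (f w) - b by case: (f w).
by rewrite distrC [X in _ + X]distrC ltrD//; near: w.
Unshelve. all: by end_near. Qed.

Lemma disc_ext0_near f (z0 : R[i]^o) : inB f -> cmod z0 = 1 -> disc_ext f z0 = 0 ->
  forall e, 0 < e -> exists2 d, 0 < d &
  forall z, disc z -> cmod (z - z0) < d -> cmod (f z) <= e.
Proof.
move=> fB z01 f0 e e0; have := disc_ext_cvg fB z01; rewrite f0.
move=> /cvg_rnormP/(_ _ e0); rewrite /within/= => /nbhs_rnormP[d d0 dP].
by exists d => // z zD zd; have := dP z zd zD; rewrite subr0 => /ltW.
Qed.

End Boundary.

(** * Products with polynomials *)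

Section Multipliers.
Variables (R : realType).
Local Notation cmod := (@rnorm R R[i]^o).
Local Notation lambda := (@lebesgue_measure R).
Implicit Types (f g h : R[i]^o -> R[i]^o) (p : {poly R[i]}).

Definition pmul p f : R[i]^o -> R[i]^o := fun z => p.[z] * f z.

Lemma lambda_itv01 : lambda `]0%R, 1%R[%classic = 1%E.
Proof. by rewrite lebesgue_measure_itv/= lte_fin ltr01 sube0. Qed.

Lemma is_derive_hornerC p (z : R[i]^o) :
  is_derive z 1 (fun x : R[i]^o => p.[x] : R[i]^o) (p^`()).[z].
Proof.
elim/poly_ind: p => [|p c ih].
  under eq_fun do rewrite horner0.
  by rewrite deriv0 horner0; exact: is_derive_cst.
have -> : (fun x : R[i]^o => (p * 'X + c%:P).[x] : R[i]^o) =
    ((fun x : R[i]^o => p.[x] : R[i]^o) * (id : R[i]^o -> R[i]^o) + cst c)%R.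
  by apply/funext => x; rewrite hornerMXaddC.
have hD := is_deriveD (is_deriveM ih (is_derive_id z 1)) (is_derive_cst (c : R[i]^o) z 1).
apply: (is_derive_eq hD).
rewrite derivMXaddC hornerD hornerMX addr0 /GRing.scale/= mulr1.
by rewrite mulrC.
Qed.

Lemma horner_bounded p : exists2 C : R, 0 < C & forall z : R[i], cmod z <= 1 -> cmod p.[z] <= C.
Proof.
elim/poly_ind: p => [|p c [C C0 CP]].
  by exists 1 => // z _; rewrite horner0 rnorm0.
exists (C + cmod c); first by rewrite ltr_pwDl// rnorm_ge0.
move=> z z1; rewrite hornerMXaddC (le_trans (ler_rnormD _ _))// lerD2r.
by rewrite rnormM -[C]mulr1 ler_pM ?rnorm_ge0// CP.
Qed.

Lemma derivable_hornerM p f (z : R[i]^o) : derivable f z 1 ->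
  derivable (pmul p f) z 1 /\
  derive1 (pmul p f) z = p.[z] * derive1 f z + (p^`()).[z] * f z.
Proof.
move=> fz.
have dp := is_derive_hornerC p z.
have df : is_derive z 1 f (derive1 f z) by rewrite derive1E; exact: DeriveDef.
have := is_deriveM dp df => -[dpf dpfE]; split=> //.
by rewrite derive1E dpfE /GRing.scale/= [f z * _]mulrC.
Qed.

(** Closure under sums of two arbitrary elements would require a subadditive
    integral.  Here the product rule gives [|(p f)'| <= C' K + C |f'|], where only
    one summand depends on [f']. *)
Lemma inB_horner p f : inB f -> inB (pmul p f).
Proof.
move=> fB; have [fh f_fin] := fB; split=> [z zD|].
  exact: (derivable_hornerM p (fh z zD)).1.
have [K K0 KP] := inB_bounded fB.
have [C C0 CP] := horner_bounded p.
have [C' C'0 C'P] := horner_bounded p^`().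
have mD : measurable (`]0%R, 1%R[%classic : set R) := measurable_itv _.
rewrite B0normE.
apply: (@le_lt_trans _ _ (\int[lambda]_(r in `]0%R, 1%R[) (cst (C' * K) r)%:E +
    \int[lambda]_(r in `]0%R, 1%R[) (C%:E * max_speed f r))%E).
  apply: (@lower_integral_le_add _ _ _ lambda _ _ _ _ (measurable_itv _)).
  - exact: measurable_cst.
  - by move=> r _ /=; rewrite mulr_ge0// ltW.
  - by move=> r _; exact: max_speed_ge0.
  - by move=> r _; rewrite mule_ge0 ?max_speed_ge0// lee_fin ltW.
  - move=> r /=; rewrite in_itv/= => /andP[r0 r1].
    apply: ge_ereal_sup => _ [t tpi <-].
    have zD : disc (polar r t) by rewrite disc_polar gtr0_norm.
    have z1 : cmod (polar r t) <= 1 by rewrite cmod_polar gtr0_norm// ltW.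
    rewrite (derivable_hornerM p (fh _ zD)).2.
    apply: (@le_trans _ _ ((C' * K)%:E + C%:E * (cmod (derive1 f (polar r t)))%:E)%E).
      rewrite -EFinM -EFinD lee_fin addrC (le_trans (ler_rnormD _ _))// !rnormM.
      by rewrite lerD// ?ler_wpM2r ?rnorm_ge0 ?CP// ler_pM ?rnorm_ge0 ?C'P ?KP.
    by rewrite leeD2l// lee_wpmul2l ?lee_fin ?(ltW C0)// le_max_speed.
apply: lte_add_pinfty.
  rewrite (eq_integral (cst (C' * K)%:E))// (integral_cst lambda (measurable_itv _)).
  rewrite [X in (_ * X)%E](_ : _ = 1%E); first by rewrite mule1 ltry.
  exact: lambda_itv01.
apply: le_lt_trans (lower_integralZ_le lambda (measurable_itv _) _ C0) _.
  by move=> r _; exact: max_speed_ge0.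
by rewrite lte_mul_pinfty// ?lee_fin ?ltW.
Qed.

Lemma supnorm_le f (L : R) : (forall z, disc z -> cmod (f z) <= L) ->
  (supnorm f <= L%:E)%E.
Proof. by move=> fL; apply: ge_ereal_sup => _ [z zD <-]; rewrite lee_fin fL. Qed.

(** In the product rule for [z^n h], the term [n z^(n-1) h] is at most
    [L n r^(n-1)] on the circle of radius [r] and integrates to [L]; the term
    [z^n h'] carries the weight [r^n], whose integral tends to [0].  The sup norm
    accounts for the other [L]. *)
Lemma Bnorm_shift_le h (L e : R) : inB h -> (forall z, disc z -> cmod (h z) <= L) ->
  0 < e -> exists N, forall n, (N <= n)%N ->
  (Bnorm (pmul 'X^n h) <= (L *+ 2 + e)%:E)%E.
Proof.
move=> hB hL e0; have [hh h_fin] := hB.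
have L0 : 0 <= L.
  by apply: le_trans (hL 0 _); [exact: rnorm_ge0|rewrite discE rnorm0].
have e2 : 0 < e / 2 by rewrite divr_gt0.
rewrite B0normE in h_fin.
have [C C0 CP] := @lower_integral_weight _ _ _ lambda _ _ _ (measurable_itv _)
  (fun r _ => max_speed_ge0 h r) h_fin e2.
exists (Num.truncn (C / (e / 2))).+1 => -[//|n] nN.
rewrite mulr2n -addrA EFinD; apply: leeD.
  apply: supnorm_le => z; rewrite discE => z1; rewrite /pmul hornerXn rnormM rnormX.
  by rewrite -[L]mul1r ler_pM ?hL ?discE ?exprn_ge0 ?rnorm_ge0// exprn_ile1 ?rnorm_ge0// ltW.
rewrite B0normE.
apply: (@le_trans _ _ (\int[lambda]_(r in `]0%R, 1%R[) (L * n.+1%:R * r ^+ n)%:E +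
    \int[lambda]_(r in `]0%R, 1%R[) ((r ^+ n.+1)%:E * max_speed h r))%E).
  apply: (@lower_integral_le_add _ _ _ lambda _ _ _ _ (measurable_itv _)).
  - apply: measurable_funM; [exact: measurable_cst|].
    by apply: measurable_funTS; exact: exprn_measurable.
  - by move=> r /=; rewrite in_itv/= => /andP[r0 _]; rewrite !mulr_ge0// exprn_ge0// ltW.
  - by move=> r _; exact: max_speed_ge0.
  - move=> r /=; rewrite in_itv/= => /andP[r0 _].
    by rewrite mule_ge0 ?max_speed_ge0// lee_fin exprn_ge0// ltW.
  - move=> r /=; rewrite in_itv/= => /andP[r0 r1].
    apply: ge_ereal_sup => _ [t tpi <-].
    have zD : disc (polar r t) by rewrite disc_polar gtr0_norm.
    rewrite (derivable_hornerM _ (hh _ zD)).2.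
    apply: (@le_trans _ _ ((L * n.+1%:R * r ^+ n)%:E +
        (r ^+ n.+1)%:E * (cmod (derive1 h (polar r t)))%:E)%E).
      rewrite -EFinM -EFinD lee_fin addrC (le_trans (ler_rnormD _ _))// !rnormM.
      rewrite derivXn hornerMn !hornerXn -mulr_natr !rnormM !rnormX cmod_polar gtr0_norm//.
      rewrite lerD// -[n.+1%:R in leLHS](rmorph_nat (real_complex R)) rnorm_real normr_nat.
      have -> : L * n.+1%:R * r ^+ n = r ^+ n * n.+1%:R * L by ring.
      by rewrite ler_wpM2l ?hL// mulr_ge0// exprn_ge0// ltW.
    by rewrite leeD2l// lee_wpmul2l ?lee_fin ?exprn_ge0 ?(ltW r0)// le_max_speed.
rewrite EFinD; apply: leeD.
  have -> : (\int[lambda]_(r in `]0%R, 1%R[) (L * n.+1%:R * r ^+ n)%:E =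
      \int[lambda]_(r in `]0%R, 1%R[) ((L * n.+1%:R)%:E * (r ^+ n)%:E))%E.
    by apply: eq_integral => r _; rewrite EFinM.
  rewrite (@ge0_integralZl_EFin _ _ _ lambda _ (measurable_itv _)).
  - by rewrite integral_exprn01 -EFinM mulfK// pnatr_eq0.
  - by move=> r /=; rewrite in_itv/= => /andP[r0 _]; rewrite lee_fin exprn_ge0// ltW.
  - apply/measurable_EFinP; apply: measurable_funTS; exact: exprn_measurable.
  - by rewrite mulr_ge0.
apply: (le_trans (CP _ _ _)).
- by apply: measurable_funTS; exact: exprn_measurable.
- move=> r /=; rewrite in_itv/= => /andP[r0 r1].
  by rewrite exprn_ge0 ?exprn_ile1// ltW.
rewrite integral_exprn01 -EFinM -EFinD lee_fin [leRHS](splitr e) lerD2l.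
rewrite ler_pdivrMr// mulrC -ler_pdivrMr// (le_trans (ltW (truncnS_gt _)))//.
by rewrite ler_nat (leq_trans nN)// leqnSn.
Qed.

End Multipliers.

(** * Polynomial partitions of the circle *)

Section CirclePartition.
Variables (R : realType).
Local Notation cmod := (@rnorm R R[i]^o).

Lemma polar1D (s t : R) : polar 1 (s + t) = polar 1 s * polar 1 t.
Proof.
rewrite /polar rmorph1 !mul1r cosD sinD.
by apply/eqP; rewrite eq_complex/= eqxx/= [X in X == _]addrC.
Qed.

Lemma polar10 : polar 1 0 = 1 :> R[i].
Proof. by rewrite /polar cos0 sin0 mul1r. Qed.

Lemma polar1X (t : R) n : polar 1 t ^+ n = polar 1 (t *+ n).
Proof.
elim: n => [|n ih]; first by rewrite mulr0n polar10.
by rewrite exprS ih mulrS polar1D.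
Qed.

Lemma polar1_neq1 (t : R) : 0 < t < pi *+ 2 -> polar 1 t != 1.
Proof.
move=> /andP[t0 tpi]; apply/negP => /eqP.
rewrite /polar mul1r => -[ct _].
have s0 : 0 < sin (t / 2).
  by apply: sin_gt0_pi; apply/andP; split; [lra|rewrite ltr_pdivrMr// mulr_natr].
have := cos_mulr2n (t / 2).
rewrite (_ : t / 2 *+ 2 = t); last by lra.
rewrite ct cos2sin2; have : 0 < sin (t / 2) ^+ 2 by rewrite exprn_gt0.
lra.
Qed.

Definition unity_root N : R[i] := polar 1 (pi *+ 2 / N.+1%:R).

Lemma unity_root_prim N : N.+1.-primitive_root (unity_root N).
Proof.
have pi2 : 0 < pi *+ 2 :> R by rewrite mulr2n addr_gt0 ?pi_gt0.
apply/andP; split=> //; apply/forallP => i; apply/eqP.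
rewrite unity_rootE /unity_root polar1X.
have [->|iN] := eqVneq i.+1 N.+1.
  rewrite -[X in polar 1 X]mulr_natr divfK ?pnatr_eq0// /polar cos2pi sin2pi mul1r.
  by rewrite !eqxx.
apply/negbTE/polar1_neq1; apply/andP; split.
  by rewrite pmulrn_lgt0// divr_gt0.
rewrite -[ltLHS]mulr_natr mulrAC ltr_pdivrMr// ltr_pM2l//.
by rewrite ltr_nat ltn_neqAle iN ltn_ord.
Qed.

Lemma cmod_unity_root N k : cmod (unity_root N ^+ k) = 1.
Proof. by rewrite rnormX cmod_polar normr1 expr1n. Qed.

Lemma sum_prim_root (F : fieldType) n (w : F) m : n.-primitive_root w ->
  \sum_(k < n) (w ^+ k) ^+ m = if (n %| m)%N then n%:R else 0.
Proof.
move=> wP; under eq_bigr => k _ do rewrite exprAC.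
rewrite (prim_order_dvd wP); case: eqP => [->|/eqP wm].
  by under eq_bigr do rewrite expr1n; rewrite sumr_const card_ord.
have := subrX1 (w ^+ m) n; rewrite exprAC (prim_expr_order wP) expr1n subrr.
by move/esym/eqP; rewrite mulf_eq0 subr_eq0 (negbTE wm) => /eqP.
Qed.

(** Expanding the power, only the exponent [i = N] survives: [i + 1] runs over
    [1, ..., 2 N + 1], where [N + 1] is the only multiple of [N + 1]. *)
Lemma sum_prim_root_binomial (F : fieldType) N (w z : F) :
  N.+1.-primitive_root w ->
  \sum_(k < N.+1) w ^+ k * (z + w ^+ k) ^+ (N + N) =
  (N.+1 * 'C(N + N, N))%:R * z ^+ N.
Proof.
move=> wP.
transitivity (\sum_(i < (N + N).+1) (z ^+ (N + N - i) *+ 'C(N + N, i)) *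
    \sum_(k < N.+1) (w ^+ k) ^+ i.+1).
  under [RHS]eq_bigr do rewrite mulr_sumr.
  rewrite exchange_big/=; apply: eq_bigr => k _.
  rewrite exprDn mulr_sumr; apply: eq_bigr => i _.
  by rewrite exprS mulrnAr mulrnAl mulrCA.
have iN : (N < (N + N).+1)%N by rewrite ltnS leq_addr.
rewrite (bigD1 (Ordinal iN))//= [X in _ + X]big1 ?addr0 => [|i iNN].
  rewrite sum_prim_root// dvdnn addnK -mulr_natl mulrAC natrM.
  by rewrite [X in X * _]mulrC.
rewrite sum_prim_root//; case: ifPn => [/dvdnP[q iq]|_]; last by rewrite mulr0.
have := ltn_ord i; rewrite -ltnS iq => q2.
move: iq iNN q2; case: q => [|[|q]]//; last by move=> _ _ /=; nia.
by rewrite mul1n => -[iN'] /eqP; case; apply: val_inj.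
Qed.

(** Parseval: [|z + u|^(2 N)] is the squared modulus of the polynomial
    [(z + u)^N] in [u], so that averaging over the roots of unity [u] of order
    [N + 1 > N] leaves the sum of the [C(N, i)^2 |z|^(2 (N - i))], which is at most
    [C(2 N, N)] by the identity of Vandermonde. *)
Lemma sum_unity_root_norm_le N (z : R[i]^o) : cmod z <= 1 ->
  \sum_(k < N.+1) cmod (z + unity_root N ^+ k) ^+ (N + N) <=
  (N.+1 * 'C(N + N, N))%:R.
Proof.
set w := unity_root N => z1; have wP : N.+1.-primitive_root w := unity_root_prim N.
suff -> : \sum_(k < N.+1) cmod (z + w ^+ k) ^+ (N + N) =
    N.+1%:R * \sum_(i < N.+1) 'C(N, i)%:R ^+ 2 * (cmod z ^+ 2) ^+ (N - i).
  rewrite natrM ler_wpM2l// -binomial.Vandermonde natr_sum ler_sum// => i _.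
  rewrite natrM bin_sub ?leq_ord// expr2 ler_piMr ?mulr_ge0//.
  by rewrite exprn_ile1 ?exprn_ge0 ?rnorm_ge0// exprn_ile1 ?rnorm_ge0.
apply: complexI; rewrite rmorph_sum rmorphM rmorph_sum rmorph_nat/=.
have wJ k : (w ^+ k)^*%C = (w ^+ k) ^+ N.
  have w0 : w ^+ k != 0.
    by apply/eqP => wk; have := cmod_unity_root N k; rewrite -/w wk rnorm0; lra.
  apply: (mulfI w0); rewrite -exprS -rnorm_sqrJ cmod_unity_root expr1n.
  by rewrite exprAC (prim_expr_order wP) expr1n.
transitivity (\sum_(i < N.+1) \sum_(j < N.+1)
    ((z ^+ (N - i) * (z^*)%C ^+ (N - j)) *+ 'C(N, j) *+ 'C(N, i)) *
    \sum_(k < N.+1) (w ^+ k) ^+ (i + N * j)).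
  under [RHS]eq_bigr do under eq_bigr do rewrite mulr_sumr.
  under [RHS]eq_bigr do rewrite exchange_big/=.
  rewrite [RHS]exchange_big/=; apply: eq_bigr => k _.
  rewrite addnn -mul2n exprM rmorphXn/= rnorm_sqrJ rmorphD/= wJ exprMn.
  rewrite !exprDn big_distrlr/=; apply: eq_bigr => i _; apply: eq_bigr => j _.
  by rewrite exprD exprM mulrnAl mulrnAr !mulrnAl mulrACA.
rewrite mulr_sumr; apply: eq_bigr => i _.
have ijE (j : 'I_N.+1) : (N.+1 %| i + N * j)%N = (j == i).
  apply/idP/eqP => [|->]; last by rewrite -mulSn dvdn_mulr.
  move=> /eqP dv; apply: val_inj => /=.
  have : (i + N * j + j = j * N.+1 + i)%N by lia.
  move/(congr1 (modn ^~ N.+1)); rewrite -modnDml dv add0n modnMDl.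
  by rewrite !modn_small.
rewrite (bigD1 i)//= [X in _ + X]big1 ?addr0 => [|j ji].
  rewrite sum_prim_root// ijE eqxx rmorphM rmorphXn/= rmorph_nat rmorphXn/= rnorm_sqrJ exprMn.
  by rewrite -mulrnA -[X in X * _]mulr_natl natrM mulrC -expr2.
by rewrite sum_prim_root// ijE (negbTE ji) mulr0.
Qed.

Lemma parallelogram (z u : R[i]^o) :
  cmod (z + u) ^+ 2 + cmod (z - u) ^+ 2 = (cmod z ^+ 2 + cmod u ^+ 2) *+ 2.
Proof. by rewrite !rnorm_sqr; case: z u => [a b] [c d] /=; ring. Qed.

(** On the unit circle [z^-N Q_k] is the normalized kernel
    [c |z + u_k|^(2 N)], a power of [|z + u_k|^2 = 4 - |z - u_k|^2], which peaks at
    [u_k].  Inside the disc the parallelogram law still gives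
    [|z + u_k|^2 <= 4 - |z - u_k|^2]. *)
Lemma circle_partition N :
  exists (u : 'I_N.+1 -> R[i]) (Q : 'I_N.+1 -> {poly R[i]}),
  [/\ forall k, cmod (u k) = 1,
      forall z, \sum_k (Q k).[z] = z ^+ N,
      forall z, cmod z <= 1 -> \sum_k cmod (Q k).[z] <= 1 &
      forall k z, cmod z <= 1 ->
        cmod (Q k).[z] <= (1 - cmod (z - u k) ^+ 2 / 4) ^+ N].
Proof.
pose u (k : 'I_N.+1) := unity_root N ^+ k.
pose c : R := (N.+1 * 'C(N + N, N))%:R.
have c0 : 0 < c by rewrite ltr0n muln_gt0/= bin_gt0 leq_addr.
exists u, (fun k => (c^-1)%:C *: (u k *: ('X + (u k)%:P) ^+ (N + N))).
have uN k : cmod (u k) = 1 by exact: cmod_unity_root.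
have QE k z : ((c^-1)%:C *: (u k *: ('X + (u k)%:P) ^+ (N + N))).[z] =
    (c^-1)%:C * (u k * (z + u k) ^+ (N + N)).
  by rewrite !hornerE.
have QN k z : cmod ((c^-1)%:C *: (u k *: ('X + (u k)%:P) ^+ (N + N))).[z] =
    c^-1 * cmod (z + u k) ^+ (N + N).
  by rewrite QE !rnormM uN mul1r rnormX rnorm_real gtr0_norm// invr_gt0.
have Q1 z : cmod z <= 1 -> \sum_k c^-1 * cmod (z + u k) ^+ (N + N) <= 1.
  by move=> z1; rewrite -mulr_sumr ler_pdivrMl// mulr1 sum_unity_root_norm_le.
split=> //.
- move=> z; under eq_bigr do rewrite QE.
  rewrite -mulr_sumr sum_prim_root_binomial ?unity_root_prim// mulrA.
  by rewrite -(rmorph_nat (real_complex R)) -rmorphM mulVf ?gt_eqF// rmorph1 mul1r.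
- by move=> z z1; under eq_bigr do rewrite QN; exact: Q1.
- move=> k z z1; rewrite QN.
  have h4 : c^-1 * 4 ^+ N <= 1.
    have := @Q1 1; rewrite rnorm1 => /(_ (lexx _)); apply: le_trans.
    rewrite (bigD1 ord0)//= /u expr0 -[1 + 1]/(2%:R) addnn -mul2n exprM.
    have -> : cmod 2%:R = 2 by rewrite -(rmorph_nat (real_complex R)) rnorm_real normr_nat.
    rewrite (_ : 2 ^+ 2 = 4); last by ring.
    by rewrite lerDl sumr_ge0// => i _; rewrite mulr_ge0 ?exprn_ge0 ?rnorm_ge0// invr_ge0 ltW.
  have := parallelogram z (u k); rewrite uN addnn -mul2n exprM => pz.
  have z2 : cmod z ^+ 2 <= 1 by rewrite exprn_ile1 ?rnorm_ge0.
  set s := cmod (z - u k) ^+ 2 in pz *.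
  have s0 : 0 <= cmod (z + u k) ^+ 2 by rewrite exprn_ge0 ?rnorm_ge0.
  apply: (@le_trans _ _ (c^-1 * (4 * (1 - s / 4)) ^+ N)).
    apply: ler_wpM2l; first by rewrite invr_ge0 ltW.
    apply: lerXn2r; rewrite ?nnegrE//; lra.
  rewrite exprMn mulrA ler_piMl// exprn_ge0//; lra.
Qed.

End CirclePartition.

(** * Operators bounded below *)

Section OpNorm.
Variables (R : realType) (X : completeNormedModType R[i]).
Implicit Types (A : X -> X).

Lemma opnorm_ge0 A : (0 <= opnorm A)%E.
Proof.
apply: (@le_trans _ _ (rnorm (A 0))%:E); first by rewrite lee_fin rnorm_ge0.
by apply: ereal_sup_ubound; exists 0 => //=; rewrite rnorm0 ler01.
Qed.

Lemma opnorm_le A (C : R) : (forall x, rnorm x <= 1 -> rnorm (A x) <= C) ->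
  (opnorm A <= C%:E)%E.
Proof. by move=> AleC; apply: ge_ereal_sup => _ [x x1 <-]; rewrite lee_fin AleC. Qed.

Lemma rnorm_le_opnorm A (C : R) x : (opnorm A <= C%:E)%E -> rnorm x <= 1 ->
  rnorm (A x) <= C.
Proof.
move=> AleC x1; rewrite -lee_fin; apply: le_trans AleC.
by apply: ereal_sup_ubound; exists x.
Qed.

Lemma bounded_op_bound (S : bounded_op X) : exists2 C, 0 < C &
  forall x, rnorm (S x) <= C * rnorm x.
Proof.
have Sfin : opnorm S \is a fin_num.
  by rewrite ge0_fin_numE ?opnorm_ge0//; exact: op_bounded.
exists (fine (opnorm S) + 1); first by rewrite ltr_wpDl// fine_ge0// opnorm_ge0.
move=> x; have [x0|x0] := eqVneq (rnorm x) 0.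
  by rewrite (rnorm_eq0 x0) linear0 rnorm0 mulr0.
have xgt0 : 0 < rnorm x by rewrite lt_neqAle eq_sym x0 rnorm_ge0.
have : rnorm (S (((rnorm x)^-1)%:C *: x)) <= fine (opnorm S).
  apply: rnorm_le_opnorm; first by rewrite fineK.
  by rewrite rnormZ rnorm_real gtr0_norm ?invr_gt0// mulVf.
rewrite linearZ rnormZ rnorm_real gtr0_norm ?invr_gt0// ler_pdivrMl// mulrC.
by move=> /le_trans; apply; rewrite ler_wpM2r ?rnorm_ge0// lerDl.
Qed.

Definition bounded_below (T : bounded_op X) (u : R[i]) (C : R) :=
  forall y, rnorm y <= C * rnorm (u *: y - T y).

Lemma bounded_below_resolvent (T : bounded_op X) u : ~ spectrum T u ->
  exists2 C, 0 < C & bounded_below T u C.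
Proof.
move=> /contrapT[S [SK _]]; have [C C0 CP] := bounded_op_bound S.
by exists C => // y; rewrite -{1}(SK y).
Qed.

(** The error [C |u - v| |y| <= |y| / 2] is absorbed by the left-hand side. *)
Lemma bounded_below_near (T : bounded_op X) u v C : 0 < C ->
  bounded_below T u C -> C * rnorm (u - v : R[i]^o) <= 1 / 2 ->
  bounded_below T v (C * 2).
Proof.
move=> C0 uC uv y.
have : rnorm (u *: y - T y) <= rnorm (v *: y - T y) + rnorm (u - v : R[i]^o) * rnorm y.
  rewrite -rnormZ (le_trans _ (ler_rnormD _ _))//.
  by rewrite scalerBl [X in _ <= rnorm X]addrC addrA subrK.
have := uC y; have := rnorm_ge0 y.
set a := rnorm y; set b := rnorm (u *: y - T y); set c := rnorm (v *: y - T y).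
set d := rnorm _ in uv *; move=> a0 h1 h2.
have : C * b <= C * (c + d * a) by rewrite ler_wpM2l// ltW.
have : C * d * a <= 1 / 2 * a by rewrite ler_wpM2r.
nra.
Qed.

Lemma bounded_below_weaken (T : bounded_op X) u (C C' : R) :
  bounded_below T u C -> C <= C' -> bounded_below T u C'.
Proof.
by move=> uC CC' y; rewrite (le_trans (uC y))// ler_wpM2r ?rnorm_ge0.
Qed.

End OpNorm.

Section CircleCover.
Variables (R : realType) (X : completeNormedModType R[i]).
Variables (T : bounded_op X) (f : R[i]^o -> R[i]^o).
Local Notation cmod := (@rnorm R R[i]^o).
Hypotheses (fB : inB f) (f0 : forall z, unitary_spectrum T z -> disc_ext f z = 0).

Lemma polar1_near (t d : R) : 0 < d ->
  \forall s \near t, cmod (polar 1 s - polar 1 t) < d.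
Proof.
move=> d0; have d2 : 0 < d / 2 by rewrite divr_gt0.
have /cvgrPdist_lt/(_ _ d2) ct := @continuous_cos R t.
have /cvgrPdist_lt/(_ _ d2) st := @continuous_sin R t.
near=> s; rewrite (le_lt_trans (ler_cmod_ReIm _))// (splitr d).
rewrite /polar !mul1r /= ltrD//; rewrite distrC; near: s; [exact: ct|exact: st].
Unshelve. all: by end_near. Qed.

(** Near a spectral point [f] is small, since its boundary value there is [0];
    near any other point a lower bound holds.  A single integer [n] bounds both the
    constant and the radius, so that compactness of the circle makes it
    uniform. *)
Lemma circle_dichotomy (e : R) : 0 < e -> exists n : nat,
  forall u : R[i], cmod u = 1 -> bounded_below T u n.+1%:R \/
    (forall z, disc z -> cmod (z - u) < n.+1%:R^-1 -> cmod (f z) <= e).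
Proof.
move=> e0.
pose P (n : nat) (t : R) := bounded_below T (polar 1 t) n.+1%:R \/
    (forall z, disc z -> cmod (z - polar 1 t) < n.+1%:R^-1 -> cmod (f z) <= e).
suff : \forall n \near \oo, `[- pi, pi]%classic `<=` P n.
  move=> [n _ nP]; exists n => u u1.
  have [t tpi uE] := polar_surj (u : R[i]^o).
  by move: (nP n (leqnn n) t tpi); rewrite /P -u1 -uE.
have /compact_near_coveringP := @segment_compact R (- pi) pi.
apply => t _.
have ut : cmod (polar 1 t) = 1 by rewrite cmod_polar normr1.
have [spec|/bounded_below_resolvent[C C0 CP]] := pselect (spectrum T (polar 1 t)).
  have [] := @disc_ext0_near _ _ (polar 1 t) fB ut _ e e0.
    by apply: f0; split => //; apply/circleE.
  move=> d d0 dP; have d2 : 0 < d / 2 by rewrite divr_gt0.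
  near=> s n; right => z zD zs; apply: dP => //.
  have h1 : cmod (polar 1 s - polar 1 t) < d / 2 by near: s; exact: polar1_near.
  have h2 : n.+1%:R^-1 < d / 2 by near: n; exact: near_infty_natSinv_lt (PosNum d2).
  rewrite (le_lt_trans (@ler_rnormB _ R[i]^o _ (polar 1 s) _))// (splitr d) ltrD//.
  exact: lt_trans zs h2.
have c2 : 0 < (C * 2)^-1 by rewrite invr_gt0 mulr_gt0.
near=> s n; left.
have h1 : cmod (polar 1 s - polar 1 t) < (C * 2)^-1 by near: s; exact: polar1_near.
have h2 : C * 2 <= n.+1%:R.
  rewrite (le_trans (ltW (truncnS_gt _)))// ler_nat ltnS.
  by near: n; exact: nbhs_infty_ge.
apply: bounded_below_weaken h2; apply: (bounded_below_near C0 CP).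
rewrite rnormB mulrC -ler_pdivlMr// (le_trans (ltW h1))//.
by rewrite invfM mul1r mulrC.
Unshelve. all: by end_near. Qed.

End CircleCover.

(** * The calculus along powers of the operator *)

Section Calculus.
Variables (R : realType) (X : completeNormedModType R[i]).
Variables (T : bounded_op X) (Phi : (R[i]^o -> R[i]^o) -> bounded_op X).
Variable (f : R[i]^o -> R[i]^o).
Local Notation cmod := (@rnorm R R[i]^o).
Local Notation C1 := (fun _ : R[i]^o => 1 : R[i]^o).
Hypotheses (PhiP : bounded_B_calculus T Phi) (fB : inB f).
Implicit Types p q : {poly R[i]}.

Lemma inB_cst1 : inB C1.
Proof.
split=> [z _|]; first exact: derivable_cst.
rewrite B0normE integral0_eq ?ltry// => r _; apply/eqP; rewrite eq_le max_speed_ge0 andbT.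
by apply: max_speed_le => z _; rewrite derive1_cst rnorm0.
Qed.

Lemma inB_id : inB (fun z : R[i]^o => z).
Proof.
have -> : (fun z : R[i]^o => z) = pmul 'X C1.
  by apply/funext => z; rewrite /pmul hornerX mulr1.
exact: inB_horner inB_cst1.
Qed.

Local Notation V p := (Phi (pmul p f)).

Lemma calculus_hornerD p q x : V (p + q) x = V p x + V q x.
Proof.
rewrite -(calculusD PhiP); [|exact: inB_horner..].
by congr (Phi _ x); apply/funext => z; rewrite /pmul hornerD mulrDl.
Qed.

Lemma calculus_hornerZ (c : R[i]) p x : V (c *: p) x = c *: V p x.
Proof.
rewrite -(calculusZ PhiP); last exact: inB_horner.
by congr (Phi _ x); apply/funext => z; rewrite /pmul hornerZ mulrA.
Qed.

Lemma calculus_hornerX p x : V ('X * p) x = T (V p x).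
Proof.
rewrite -(calculus_id PhiP) -(calculusM PhiP); [|exact: inB_id|exact: inB_horner].
by congr (Phi _ x); apply/funext => z; rewrite /pmul hornerM hornerX mulrA.
Qed.

Lemma calculus_hornerXn n p x : V ('X^n * p) x = iter n T (V p x).
Proof.
elim: n => [|n ih]; first by rewrite expr0 mul1r.
by rewrite exprS -mulrA calculus_hornerX ih.
Qed.

Lemma calculus_horner_sum (I : Type) (r : seq I) (P : pred I) (F : I -> {poly R[i]}) x :
  V (\sum_(i <- r | P i) F i) x = \sum_(i <- r | P i) V (F i) x.
Proof.
elim/big_rec2: _ => [|i y p _ <-]; last by rewrite calculus_hornerD.
by rewrite -(scale0r (0 : {poly R[i]})) calculus_hornerZ scale0r.
Qed.

Lemma calculus_factor (u : R[i]) p x :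
  V ((u%:P - 'X) * p) x = u *: V p x - T (V p x).
Proof.
have -> : (u%:P - 'X) * p = u *: p + (-1) *: ('X * p).
  by rewrite mulrBl mul_polyC scaleN1r.
by rewrite calculus_hornerD !calculus_hornerZ calculus_hornerX scaleN1r.
Qed.

(** The lower bound is applied to vectors of the form [Phi (q f) x], on which
    [u - T] acts as multiplication of [q] by [u - 'X]. *)
Lemma bounded_below_iter (u : R[i]) C m n p x : 0 <= C -> bounded_below T u C ->
  rnorm (iter n T (V p x)) <= C ^+ m * rnorm (iter n T (V ((u%:P - 'X) ^+ m * p) x)).
Proof.
move=> C0 uC; elim: m => [|m ih]; first by rewrite expr0 !mul1r.
apply: (le_trans ih); rewrite exprSr -mulrA ler_wpM2l ?exprn_ge0//.
have := uC (iter n T (V ((u%:P - 'X) ^+ m * p) x)).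
rewrite -!calculus_hornerXn -calculus_factor.
have -> // : (u%:P - 'X) * ('X^n * ((u%:P - 'X) ^+ m * p)) =
  'X^n * ((u%:P - 'X) ^+ m.+1 * p).
by rewrite mulrCA [X in _ * X = _]mulrA -exprS.
Qed.

Lemma calculus_bound_gt0 : exists2 M : R, 0 < M &
  forall h, inB h -> (opnorm (Phi h) <= M%:E * Bnorm h)%E.
Proof.
have [M MP] := calculus_bounded PhiP.
exists (Num.max M 1); first by rewrite lt_max ltr01 orbT.
move=> h hB; apply: (le_trans (MP h hB)); apply: lee_wpmul2r.
  rewrite adde_ge0//.
    apply: (@le_trans _ _ (cmod (h 0))%:E); first by rewrite lee_fin rnorm_ge0.
    by apply: ereal_sup_ubound; exists 0 => //; rewrite discE rnorm0.
  by rewrite B0normE integral_ge0// => r _; exact: max_speed_ge0.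
by rewrite lee_fin le_max lexx.
Qed.

Lemma calculus_iter_le M p (L e : R) :
  (forall h, inB h -> (opnorm (Phi h) <= M%:E * Bnorm h)%E) -> 0 <= M ->
  (forall z, disc z -> cmod (p.[z] * f z) <= L) -> 0 < e ->
  exists N, forall n, (N <= n)%N -> forall x, rnorm x <= 1 ->
  rnorm (iter n T (V p x)) <= M * (L *+ 2 + e).
Proof.
move=> MP M0 pL e0.
have pB : inB (pmul p f) := inB_horner p fB.
have [N NP] := Bnorm_shift_le pB pL e0.
exists N => n nN x x1.
have pE : pmul ('X^n * p) f = pmul 'X^n (pmul p f).
  by apply/funext => z; rewrite /pmul hornerM mulrA.
rewrite -calculus_hornerXn pE; apply: rnorm_le_opnorm => //.
apply: (le_trans (MP _ (inB_horner _ pB))).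
by rewrite EFinM; apply: lee_wpmul2l; [rewrite lee_fin|exact: NP].
Qed.

End Calculus.

Section Smallness.
Variable R : realType.

(** The number [k m + 1] of pieces grows linearly with [m], the size of each one
    decays like [2^-m]. *)
Lemma linear_mul_geometric_small (k : nat) (e : R) : 0 < e ->
  exists m, (k * m).+1%:R * 2^-1 ^+ m <= e.
Proof.
move=> e0; have [j je] : exists j, 2 * k.+1%:R / e <= j.+1%:R.
  by exists (Num.truncn (2 * k.+1%:R / e)); rewrite ltW// truncnS_gt.
exists (2 * j)%N.
have j2 : (j.+1 <= 2 ^ j)%N by rewrite ltn_expl.
have jR : (j.+1)%:R <= 2 ^+ j :> R by rewrite -natrX ler_nat.
have pj : 0 < 2 ^+ j :> R by rewrite exprn_gt0.
have h1 : (k * (2 * j)).+1%:R <= 2 * k.+1%:R * 2 ^+ j :> R.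
  apply: (@le_trans _ _ (2 * k.+1%:R * j.+1%:R)); last by rewrite ler_wpM2l.
  by rewrite -!natrM ler_nat; lia.
have h2 : 2 * k.+1%:R <= 2 ^+ j * e by rewrite -ler_pdivrMr// (le_trans je).
have -> : 2^-1 ^+ (2 * j) = (2 ^+ j)^-1 * (2 ^+ j)^-1 :> R.
  by rewrite mulnC exprM expr2 exprVn.
rewrite mulrA ler_pdivrMr// ler_pdivrMr//.
have := ler_wpM2l (ltW pj) h2; lra.
Qed.

End Smallness.

(** * The decomposition *)

Section Main.
Variables (R : realType) (X : completeNormedModType R[i]).
Variables (T : bounded_op X) (Phi : (R[i]^o -> R[i]^o) -> bounded_op X).
Variable (f : R[i]^o -> R[i]^o).
Local Notation cmod := (@rnorm R R[i]^o).
Hypotheses (PhiP : bounded_B_calculus T Phi) (fB : inB f).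
Hypothesis f0 : forall z, unitary_spectrum T z -> disc_ext f z = 0.

Lemma calculus_iter_small (e : R) : 0 < e -> exists N0, forall n, (N0 <= n)%N ->
  forall x, rnorm x <= 1 -> rnorm (iter n T (Phi f x)) <= e.
Proof.
move=> e0.
have [M M0 MP] := calculus_bound_gt0 PhiP.
have [K K0 KP] := inB_bounded fB.
(* The final bound is [M (6 eps)]: [2 eps + eps] from the part where [f] is small,
   and [3 eps] from all the terms that decay with [m]. *)
pose eps := e / (6 * M).
have eps0 : 0 < eps by rewrite divr_gt0// mulr_gt0.
have [n1 n1P] := circle_dichotomy fB f0 eps0.
set C : R := n1.+1%:R in n1P.
have C1 : 1 <= C by rewrite ler1n.
have C0 : 0 < C by lra.
(* Within distance [d] of a good peak, [C |u - z| <= 1 / 2].  As [d < C^-1], the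
   same [d] also separates the two cases of the dichotomy. *)
pose d := (C * 2)^-1.
have d0 : 0 < d by rewrite invr_gt0 mulr_gt0.
have d1 : d <= 1 / 2.
  by rewrite /d invfM mul1r ler_piMl// invf_le1.
have dC : d < C^-1 by rewrite ltf_pV2 ?posrE ?mulr_gt0// ltr_pMr// ltr1n.
pose th := 1 - d ^+ 2 / 4.
have th01 : 0 < th < 1 by rewrite /th; apply/andP; split; nra.
(* [th^N] bounds a peak at distance at least [d]; taking [N = k m] lets it beat the
   factor [(2 C)^m] that the lower bound and [|u - z| <= 2] produce there. *)
have [k thk] : exists k, (C * 2) * th ^+ k <= 1 / 2.
  have c4 : 0 < (C * 2)^-1 / 2 by rewrite divr_gt0.
  have /andP[th0 th1] := th01.
  have : th ^+ n @[n --> \oo] --> (0 : R) by apply: cvg_expr; rewrite gtr0_norm.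
  move=> /cvgrPdist_le/(_ _ c4)[k _ kP]; exists k.
  have := kP k (leqnn k); rewrite sub0r normrN ger0_norm ?exprn_ge0 ?(ltW th0)//.
  by move=> h; rewrite -ler_pdivlMl ?mulr_gt0// mul1r.
have [m mP] : exists m, (k * m).+1%:R * (8 * (K * 2^-1 ^+ m)) <= 3 * eps.
  have K8 : 0 < 8 * K by rewrite mulr_gt0.
  have e1 : 0 < 3 * eps / (8 * K) by rewrite divr_gt0// mulr_gt0.
  have [m mP] := linear_mul_geometric_small k e1; exists m.
  by move: mP; rewrite ler_pdivlMr// mulrC mulrCA !mulrA.
pose N := (k * m)%N.
have [u [Q [u1 QN Qsum Qfar]]] := circle_partition R N.
have /andP[th0 th1] := th01.
have thN' : (C * 2) ^+ m * th ^+ N <= 2^-1 ^+ m.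
  by rewrite exprM -exprMn lerXn2r ?nnegrE ?mulr_ge0 ?exprn_ge0 ?(ltW th0)//; lra.
have thN : th ^+ N <= 2^-1 ^+ m.
  apply: le_trans thN'; rewrite ler_peMl ?exprn_ge0 ?(ltW th0)//.
  by rewrite exprn_ege1//; lra.
have C2m : C ^+ m * 2 ^+ m * th ^+ N <= 2^-1 ^+ m by rewrite -exprMn.
have Cdm : C ^+ m * d ^+ m = 2^-1 ^+ m.
  by rewrite -exprMn /d invfM mulrA mulfV ?mul1r// gt_eqF.
have Qth j z : disc z -> d <= cmod (z - u j) -> cmod (Q j).[z] <= th ^+ N.
  rewrite discE => z1 dz; apply: (le_trans (Qfar _ _ (ltW z1))).
  have h1 : cmod (z - u j) <= 2.
    have := ler_rnormD (z : R[i]^o) (- u j : R[i]^o); rewrite rnormN u1; lra.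
  have h2 : d ^+ 2 <= cmod (z - u j) ^+ 2 by rewrite lerXn2r ?nnegrE ?rnorm_ge0// ltW.
  have h3 : cmod (z - u j) ^+ 2 <= 2 ^+ 2 by rewrite lerXn2r ?nnegrE ?rnorm_ge0.
  by apply: lerXn2r; rewrite ?nnegrE /th; lra.
have Q1 j z : disc z -> cmod (Q j).[z] <= 1.
  rewrite discE => z1; apply: le_trans (Qsum z (ltW z1)).
  by rewrite (bigD1 j)//= lerDl sumr_ge0// => i _; exact: rnorm_ge0.
pose good j := `[< bounded_below T (u j) C >].
pose G := \sum_(j | ~~ good j) Q j.
pose L1 := eps + N.+1%:R * (K * th ^+ N).
have GL z : disc z -> cmod (G.[z] * f z) <= L1.
  move=> zD; rewrite /G horner_sum mulr_suml (le_trans (ler_rnorm_sum _ _ _))//.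
  apply: (@le_trans _ _ (\sum_(j | ~~ good j) (cmod (Q j).[z] * eps + K * th ^+ N))).
    apply: ler_sum => j; rewrite /good => /asboolPn nj; rewrite rnormM.
    have [//|fe] := n1P (u j) (u1 j).
    have [zu|zu] := ltP (cmod (z - u j)) C^-1.
      rewrite (le_trans (ler_wpM2l (rnorm_ge0 _) (fe z zD zu)))// lerDl.
      by rewrite mulr_ge0 ?(ltW K0)// exprn_ge0// ltW.
    apply: ler_wpDl; first by rewrite mulr_ge0 ?rnorm_ge0 ?(ltW eps0).
    rewrite mulrC.
    by rewrite ler_pM ?rnorm_ge0 ?KP// Qth// ltW// (lt_le_trans dC).
  rewrite big_split/= -mulr_suml; apply: lerD.
    rewrite ler_piMl ?(ltW eps0)//; move: zD; rewrite discE => zD.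
    apply: le_trans (Qsum z (ltW zD)); rewrite [leRHS](bigID good)/= lerDr.
    by rewrite sumr_ge0// => i _; exact: rnorm_ge0.
  rewrite sumr_const -[leLHS]mulr_natl ler_wpM2r//.
    by rewrite mulr_ge0 ?(ltW K0)// exprn_ge0// ltW.
  by rewrite ler_nat (leq_trans (max_card _))// card_ord.
pose L2 := K * (d ^+ m + 2 ^+ m * th ^+ N).
have L20 : 0 < L2.
  by rewrite mulr_gt0// addr_gt0 ?mulr_gt0 ?exprn_gt0.
have QL j z : disc z -> cmod ((((u j)%:P - 'X) ^+ m * Q j).[z] * f z) <= L2.
  move=> zD; rewrite hornerM horner_exp !hornerE !rnormM rnormX rnormB mulrC.
  apply: ler_pM; rewrite ?rnorm_ge0 ?mulr_ge0 ?exprn_ge0 ?rnorm_ge0 ?KP//.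
  have [zu|zu] := ltP (cmod (z - u j)) d.
    rewrite -[leLHS]addr0 lerD ?mulr_ge0 ?exprn_ge0 ?(ltW th0)//.
    rewrite -[d ^+ m]mulr1 ler_pM ?exprn_ge0 ?rnorm_ge0 ?Q1//.
    by rewrite lerXn2r ?nnegrE ?rnorm_ge0 ?ltW.
  rewrite -[leLHS]add0r lerD ?exprn_ge0 ?(ltW d0)//.
  rewrite ler_pM ?exprn_ge0 ?rnorm_ge0 ?Qth//.
  rewrite lerXn2r ?nnegrE ?rnorm_ge0//.
  move: zD; rewrite discE.
  have := ler_rnormD (z : R[i]^o) (- u j : R[i]^o); rewrite rnormN u1; lra.
(* The slack is taken to be [eps] for [G], but proportional to [L2] for the good
   pieces, since it is going to be multiplied by [C^m]. *)
have [NG NGP] := calculus_iter_le PhiP fB MP (ltW M0) GL eps0.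
have /choice[NQ NQP] : forall j, exists n0, forall n, (n0 <= n)%N ->
    forall x, rnorm x <= 1 ->
    rnorm (iter n T (Phi (pmul (((u j)%:P - 'X) ^+ m * Q j) f) x)) <= M * (L2 *+ 2 + L2).
  by move=> j; exact: (calculus_iter_le PhiP fB MP (ltW M0) (QL j) L20).
exists (N + \max_j NQ j + NG)%N => n nN x x1.
have Nn : (N <= n)%N by rewrite (leq_trans _ nN)// -addnA leq_addr.
have fE : f = pmul 1 f by apply/funext => z; rewrite /pmul hornerC mul1r.
have -> : iter n T (Phi f x) = iter (n - N) T (Phi (pmul 'X^N f) x).
  by rewrite -['X^N]mulr1 (calculus_hornerXn PhiP fB) -iterD subnK -?fE.
have NE : pmul 'X^N f = pmul (\sum_(j | good j) Q j + G) f.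
  have <- : \sum_j Q j = \sum_(j | good j) Q j + G by rewrite (bigID good).
  by apply/funext => z; rewrite /pmul hornerXn -QN horner_sum.
rewrite NE -(calculus_hornerXn PhiP fB) mulrDr (calculus_hornerD PhiP fB).
rewrite mulr_sumr (calculus_horner_sum PhiP fB) !(calculus_hornerXn PhiP fB).
have goodb j : good j ->
    rnorm (Phi (pmul ('X^(n - N) * Q j) f) x) <= M * (6 * (K * 2^-1 ^+ m)).
  move=> /asboolP gj; rewrite (calculus_hornerXn PhiP fB).
  apply: (le_trans (bounded_below_iter PhiP fB m (n - N) (Q j) x (ltW C0) gj)).
  have jn : (NQ j <= n - N)%N.
    rewrite leq_subRL// (leq_trans _ nN)// (leq_trans _ (leq_addr _ _))//.
    by rewrite leq_add2l leq_bigmax.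
  apply: (@le_trans _ _ (C ^+ m * (M * (L2 *+ 2 + L2)))).
    by rewrite ler_wpM2l ?exprn_ge0 ?(ltW C0)// NQP.
  rewrite mulrCA ler_wpM2l ?(ltW M0)// /L2.
  have : K * (C ^+ m * 2 ^+ m * th ^+ N) <= K * 2^-1 ^+ m by rewrite ler_wpM2l ?(ltW K0).
  have : K * (C ^+ m * d ^+ m) = K * 2^-1 ^+ m by rewrite Cdm.
  move: (C ^+ m) (d ^+ m) (2 ^+ m) (th ^+ N) (2^-1 ^+ m) => c1 c2 c3 c4 c5; lra.
have Gb : rnorm (iter (n - N) T (Phi (pmul G f) x)) <= M * (L1 *+ 2 + eps).
  by apply: NGP => //; rewrite leq_subRL// (leq_trans _ nN)// leq_add2r leq_addr.
apply: (le_trans (ler_rnormD _ _)).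
apply: (@le_trans _ _ (N.+1%:R * (M * (6 * (K * 2^-1 ^+ m))) + M * (L1 *+ 2 + eps))).
  apply: lerD => //; apply: (le_trans (ler_rnorm_sum _ _ _)).
  apply: (le_trans (ler_sum _ goodb)).
  rewrite sumr_const -[leLHS]mulr_natl ler_wpM2r//.
    by rewrite !mulr_ge0 ?(ltW M0) ?exprn_ge0// ltW.
  by rewrite ler_nat (leq_trans (max_card _))// card_ord.
have -> : e = M * (eps * 6) by rewrite /eps; field; rewrite gt_eqF.
have : N.+1%:R * (K * th ^+ N) <= N.+1%:R * (K * 2^-1 ^+ m).
  by rewrite ler_wpM2l// ler_wpM2l// ltW.
move=> h; rewrite [X in X + _]mulrCA -mulrDr.
apply: ler_wpM2l; first exact: ltW.
move: mP h; rewrite -/N /L1.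
by move: (th ^+ N) (2^-1 ^+ m) (N.+1%:R : R) => c1 c2 c3; lra.
Qed.

End Main.

Theorem theorem1p5 (R : realType) (X : completeNormedModType R[i])
    (T : bounded_op X) (Phi : (R[i]^o -> R[i]^o) -> bounded_op X)
    (f : R[i]^o -> R[i]^o) :
  power_bounded T ->
  bounded_B_calculus T Phi ->
  inB f ->
  (forall z, unitary_spectrum T z -> disc_ext f z = 0) ->
  opnorm (iter n T \o Phi f) @[n --> \oo] --> 0%E.
Proof.
move=> _ PhiP fB f0.
have small (e : R) : 0 < e -> \forall n \near \oo, (opnorm (iter n T \o Phi f) <= e%:E)%E.
  move=> /(calculus_iter_small PhiP fB f0)[N NP]; exists N => // n nN.
  by apply: opnorm_le => x x1; exact: NP.
apply/fine_cvgP; split.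
  have := small 1 ltr01; apply: filterS => n n1.
  by rewrite ge0_fin_numE ?opnorm_ge0// (le_lt_trans n1)// ltry.
apply/cvgrPdist_le => e e0; have := small e e0; apply: filterS => n ne.
rewrite sub0r normrN ger0_norm ?fine_ge0 ?opnorm_ge0//= -lee_fin fineK//.
by rewrite ge0_fin_numE ?opnorm_ge0// (le_lt_trans ne)// ltry.
Qed.
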